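(* For every $0<p\le 1$ there exists a constant $0<b_p<\infty$ such that, for the $p$-percentile rule, $E(A_n)/a_n(p)\to b_p$ as $n\to\infty$, where $$a_n(p)=\begin{cases} n^{1-p}, & p<1/2,\\ n^{1/2}\log n, & p=1/2,\\ n^{p}, & p>1/2,\end{cases}$$ and $$b_p=\begin{cases} c_{1/2}/8, & p=1/2,\\ \dfrac{p^2}{2(2p-1)}\,c_p, & p>1/2,\end{cases}$$ with $c_p=\lim_{n\to\infty}E(L_n)/n^p$.
   Context: $X_1,X_2,\ldots$ are i.i.d. real random variables with a continuous distribution. Smaller values are better; $R_i^n=\sum_{j=1}^n I\{X_j\le X_i\}$ is the rank of $X_i$ among $X_1,\ldots,X_n$. For fixed $0<p\le1$ the $p$-percentile rule retains items as follows: $S_1=\{1\}$, and for $n\ge 2$, $X_n$ is retained (i.e. $S_n=S_{n-1}\cup\{n\}$) if and only if $R_n^n\le\lceil pL_{n-1}\rceil$, otherwise $S_n=S_{n-1}$; here $S_n$ is the set of indices of retained items among the first $n$ and $L_n=|S_n|$. $Q_n=\sum_{i\in S_n}R_i^n$ is the sum of the ranks of the retained items and $A_n=Q_n/L_n$ is their average rank. The limit $c_p=\lim_{n\to\infty} E(L_n)/n^p$ exists and satisfies $0<c_p<\infty$. *)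

(* Defs.v *)
From HB Require Import structures.
From mathcomp Require Import all_boot all_order all_algebra finmap.
From mathcomp Require Import all_classical all_reals all_analysis.

Set Implicit Arguments.
Unset Strict Implicit.
Unset Printing Implicit Defensive.

Import Order.TTheory GRing.Theory Num.Theory.
Import numFieldNormedType.Exports.

Local Open Scope classical_set_scope.
Local Open Scope ring_scope.

(* Items are numbered from 0: item [i] here is the item with index [i + 1] in
   the usual 1-based numbering, so the first [n] items are those of index
   [i < n]. Smaller values are better. *)

Definition independent_rvs (d : measure_display) (T : measurableType d)
    (R : realType) (P : probability T R) (X : nat -> {RV P >-> R}) : Prop :=
  forall (J : {fset nat}) (A : nat -> set R), (forall j, measurable (A j)) ->
    P (\bigcap_(j in [set` J]) (X j @^-1` A j)) =
    (\prod_(j <- J) P (X j @^-1` A j))%E.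

Definition identically_distributed (d : measure_display) (T : measurableType d)
    (R : realType) (P : probability T R) (X : nat -> {RV P >-> R}) : Prop :=
  forall (i j : nat) (A : set R), measurable A ->
    distribution P (X i) A = distribution P (X j) A.

Definition iid_continuous (d : measure_display) (T : measurableType d)
    (R : realType) (P : probability T R) (X : nat -> {RV P >-> R}) : Prop :=
  [/\ independent_rvs X, identically_distributed X
    & forall i, continuous (cdf (X i))].

Section percentile_rule.
Context {R : realType}.
Implicit Types (p : R) (x : nat -> R).

Definition rank x (n i : nat) : nat := \sum_(j < n) (x j <= x i)%R.

(* The item arriving after [m] items has index [m], and its rank among the
   first [m + 1] items is [rank x m.+1 m]; the first item is always retained. *)
Fixpoint retained p x (n : nat) : {fset nat} :=
  match n with
  | 0 => fset0
  | m.+1 =>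
    let S := retained p x m in
    if (m == 0)%N || ((rank x m.+1 m)%:Z <= Num.ceil (p * #|` S|%:R))
    then (m |` S)%fset else S
  end.

Definition num_retained p x (n : nat) : nat := #|` retained p x n|.

Definition sum_ranks p x (n : nat) : nat :=
  \sum_(i <- retained p x n) rank x n i.

Definition avg_rank p x (n : nat) : R :=
  (sum_ranks p x n)%:R / (num_retained p x n)%:R.

Definition a_norm p (n : nat) : R :=
  if p < 1 / 2 then n%:R `^ (1 - p)
  else if p == 1 / 2 then n%:R `^ (1 / 2) * ln n%:R
  else n%:R `^ p.

End percentile_rule.

Section expectations.
Context (d : measure_display) (T : measurableType d) (R : realType).
Context (P : probability T R).
Implicit Types (p : R) (X : nat -> {RV P >-> R}).
Local Open Scope ereal_scope.

Definition E_num_retained p X (n : nat) : \bar R :=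
  'E_P[fun w => (num_retained p (fun i => X i w) n)%:R].

Definition E_avg_rank p X (n : nat) : \bar R :=
  'E_P[fun w => avg_rank p (fun i => X i w) n].

Definition c_const p X : \bar R :=
  limn (fun n => E_num_retained p X n / (n%:R `^ p)%:E).

End expectations.

(* Main.v *)
(** The relative order of the first [n] items is a uniform random permutation, so
    everything is a statement about averages over permutations. Write [L] for the
    number of retained items, [k] for the ceiling of [p L], [Q] for the sum of the
    ranks and [A = Q / L]. Inserting a new item of uniform rank gives
    [E L' = E (L + k / (n + 1))] and
    [E A' = E A (1 + (1 - p) / (n + 1)) + (p ^ 2 / 2) E L / (n + 1) + error],
    where the error is at most [(3 / 2 + E (Q / L ^ 2)) / (n + 1)] and
    [E (Q / L ^ 2)] satisfies a similar recursion with a smaller exponent. The first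
    recursion gives [E L ~ c n ^ p]. In the second, the homogeneous solution grows
    like [n ^ (1 - p)] and the driving term contributes [n ^ p], so the larger
    exponent wins, with a logarithm when [p = 1 / 2]. When [p < 1 / 2] the limit
    constant is positive because [A] is at least the rank of the first item, which
    is always retained, divided by [L]. *)
Require Import Defs.
From mathcomp Require Import all_boot all_order all_algebra all_fingroup finmap.
From mathcomp Require Import all_classical all_reals all_analysis measurable_realfun.
From mathcomp Require Import ring lra zify.
Import Order.TTheory GRing.Theory Num.Theory.
Import numFieldNormedType.Exports.
Local Open Scope classical_set_scope.
Local Open Scope ring_scope.

Set Implicit Arguments.
Unset Strict Implicit.
Unset Printing Implicit Defensive.

(** * Linear recursions with exponent [a] *)

(* The solution of [u n.+1 = u n * (1 + a / n.+1)], comparable to [n ^ a]. *)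
Definition growth {R : realType} (a : R) (n : nat) : R :=
  \prod_(i < n) (1 + a / i.+1%:R).

Section growth.
Context {R : realType}.
Implicit Types (a s C : R) (u h : nat -> R).

Lemma growthS a n : growth a n.+1 = growth a n * (1 + a / n.+1%:R).
Proof. by rewrite /growth big_ord_recr. Qed.

Lemma growth_ge1 a n : 0 <= a -> 1 <= growth a n.
Proof.
move=> a0; elim: n => [|n IH]; first by rewrite /growth big_ord0.
by rewrite growthS -[X in X <= _]mulr1 ler_pM // lerDl divr_ge0.
Qed.

Lemma growth_gt0 a n : 0 <= a -> 0 < growth a n.
Proof. by move=> a0; exact: lt_le_trans ltr01 (growth_ge1 n a0). Qed.

Lemma ler_growth a s n : 0 <= s -> s <= a -> growth s n <= growth a n.
Proof.
move=> s0 sa; rewrite /growth; apply: ler_prod => i _.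
by rewrite addr_ge0 ?divr_ge0 //= lerD2l ler_pM2r.
Qed.

(** Division by [growth a] turns a recursive inequality into monotonicity; limits and bounds are
    extracted from the recursions in this way. *)
Lemma growth_ratio_le a u n : 0 <= a ->
  u n.+1 <= u n * (1 + a / n.+1%:R) ->
  u n.+1 / growth a n.+1 <= u n / growth a n.
Proof.
move=> a0 un.
have g1 : 0 < 1 + a / n.+1%:R by rewrite ltr_wpDr // divr_ge0.
rewrite ler_pdivrMr ?growth_gt0 // growthS mulrA divfK //.
by rewrite gt_eqF ?growth_gt0.
Qed.

Lemma growth_ratio_ge a u n : 0 <= a ->
  u n * (1 + a / n.+1%:R) <= u n.+1 ->
  u n / growth a n <= u n.+1 / growth a n.+1.
Proof.
move=> a0 un; rewrite -lerN2 -!mulNr.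
by apply: (growth_ratio_le (u := fun n => - u n)) => //; rewrite mulNr lerN2.
Qed.

Lemma nonincreasing_from1 u m n : (forall n, (0 < n)%N -> u n.+1 <= u n) ->
  (0 < m <= n)%N -> u n <= u m.
Proof.
move=> hu /andP[m0 /subnK <-]; elim: (n - m)%N => [|k IH] //.
by rewrite addSn (le_trans _ IH) // hu // addn_gt0 m0 orbT.
Qed.

(** Index 0 is left out because the recursions for the means start at index 1. *)
Lemma nondecreasing_from1_cvg u M : (forall n, (0 < n)%N -> u n <= u n.+1) ->
  (forall n, (0 < n)%N -> u n <= M) ->
  exists2 l : R, u n @[n --> \oo] --> l & forall n, (0 < n)%N -> u n <= l.
Proof.
move=> hu hM; pose v n := u n.+1.
have vnd : nondecreasing_seq v.
  by apply/nondecreasing_seqP => n; exact: hu.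
have vcv : cvgn v.
  apply: nondecreasing_is_cvgn => //.
  by exists M => _ [n _ <-]; exact: hM.
exists (limn v); first by rewrite -(cvg_shiftS u).
move=> [//|n] _; exact: nondecreasing_cvgn_le.
Qed.

(** The shift [u + C / s] absorbs the constant term and satisfies the homogeneous inequality. *)
Lemma affine_growth_bound s C u : 0 < s ->
  (forall n, (0 < n)%N ->
     u n.+1 <= u n * (1 + s / n.+1%:R) + C / n.+1%:R) ->
  exists2 K : R, 0 <= K & forall n, (0 < n)%N -> u n <= K * growth s n - C / s.
Proof.
move=> s0 hu; pose v n := u n + C / s.
have s0' := ltW s0.
exists (`|v 1%N / growth s 1|); first exact: normr_ge0.
move=> n n0; rewrite lerBrDr -ler_pdivrMr ?growth_gt0 //.
apply: le_trans (ler_norm _).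
apply: (nonincreasing_from1 (u := fun n => v n / growth s n)); last by rewrite n0.
move=> k k0; apply: growth_ratio_le => //.
rewrite /v mulrDl (le_trans (lerD (hu k k0) (lexx _))) //.
rewrite -addrA lerD2l mulrDr mulr1 addrC mulrA divfK ?gt_eqF //.
Qed.

(** When [s] exceeds [a] the source dictates the growth: [K * growth s] solves the recursion with
    source [K * (s - a) * growth s n / n.+1], which covers the given one once [K >= C / (s - a)]. *)
Lemma perturbed_growth_dominated a s C h : 0 <= a -> a < s ->
  (forall n, (0 < n)%N ->
     `|h n.+1 - h n * (1 + a / n.+1%:R)| <= C * growth s n / n.+1%:R) ->
  exists K : R, forall n, (0 < n)%N -> `|h n| <= K * growth s n.
Proof.
move=> a0 as_ hh; have sa0 : 0 < s - a by rewrite subr_gt0.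
have s0 : 0 <= s by exact: ltW (le_lt_trans a0 as_).
pose K : R := Num.max `|h 1%N| (C / (s - a)).
exists K; case=> // n _; elim: n => [|n IH].
  rewrite (le_trans (_ : _ <= K)) ?le_max ?lexx // ler_peMr ?growth_ge1 //.
  by rewrite le_max normr_ge0.
have h1 : 0 <= 1 + a / n.+2%:R by rewrite addr_ge0 ?divr_ge0.
have := hh n.+1 isT.
rewrite -[h n.+2 in X in _ -> X](subrK (h n.+1 * (1 + a / n.+2%:R))) => hn.
apply: le_trans (ler_normD _ _) _; rewrite normrM (ger0_norm h1).
apply: le_trans (lerD hn (ler_wpM2r h1 IH)) _.
rewrite [growth s n.+2]growthS; set g := growth s n.+1.
have -> : K * (g * (1 + s / n.+2%:R)) =
  K * g * (1 + a / n.+2%:R) + K * (s - a) * g / n.+2%:R.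
  by field; rewrite -natrD pnatr_eq0.
rewrite [leLHS]addrC lerD2l ler_pM2r ?invr_gt0 ?ltr0n // ler_pM2r ?growth_gt0 //.
by rewrite -ler_pdivrMr // le_max lexx orbT.
Qed.

End growth.

(** * Comparison of [growth a n] with [n ^ a] *)

Section powers.
Context {R : realType}.
Implicit Types (a s C : R) (u h : nat -> R).

(* Weighted AM-GM, obtained from [ln y <= y - 1] at [y = (1 + x) / m] and
   [y = 1 / m], where [m = 1 + a x]. *)
Lemma powR_le_affine a (x : R) : 0 <= a <= 1 -> 0 <= x ->
  (1 + x) `^ a <= 1 + a * x.
Proof.
move=> /andP[a0 a1] x0.
have x1 : 0 < 1 + x by lra.
have m0 : 0 < 1 + a * x by have := mulr_ge0 a0 x0; lra.
set m := 1 + a * x in m0 *.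
have ln_le (y : R) : 0 < y -> ln y <= y - 1.
  by move=> y0; have := @le_ln1Dx _ (y - 1); rewrite [1 + _]addrC subrK; apply; lra.
rewrite -ler_ln ?posrE ?powR_gt0 // ln_powR.
have H1 := ln_le _ (divr_gt0 x1 m0); have H2 := ln_le _ (divr_gt0 ltr01 m0).
rewrite ln_div ?posrE // in H1; rewrite ln_div ?posrE // ln1 in H2.
have H3 := ler_wpM2l a0 H1.
have H4 : (1 - a) * (0 - ln m) <= (1 - a) * (1 / m - 1).
  by apply: ler_wpM2l H2; rewrite subr_ge0.
suff E : a * ((1 + x) / m - 1) + (1 - a) * (1 / m - 1) = 0 by lra.
transitivity ((1 + a * x) / m - 1); first by ring.
by rewrite divff ?subrr // gt_eqF.
Qed.

(** This is [ln y <= y - 1] at [y = n / (n + 1)]. *)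
Lemma inv_le_ln_ratio n : (0 < n)%N -> n.+1%:R^-1 <= ln (n.+1%:R / n%:R) :> R.
Proof.
move=> n0; have n0' : 0 < n%:R :> R by rewrite ltr0n.
have q0 : 0 < n.+1%:R / n%:R :> R by rewrite divr_gt0.
have := @le_ln1Dx R (- n.+1%:R^-1).
have -> : 1 - n.+1%:R^-1 = (n.+1%:R / n%:R)^-1 :> R.
  by rewrite -natr1; field; rewrite gt_eqF //= gt_eqF // ltr_wpDr.
rewrite lnV ?posrE // lerN2; apply.
by rewrite ltrN2 invf_lt1 // ltr1n.
Qed.

Lemma one_add_div_le_powR a n : 0 <= a -> (0 < n)%N ->
  1 + a / n.+1%:R <= (n.+1%:R / n%:R) `^ a.
Proof.
move=> a0 n0.
have n0' : 0 < n%:R :> R by rewrite ltr0n.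
have an : 0 <= a / n.+1%:R by rewrite divr_ge0.
have q0 : 0 < n.+1%:R / n%:R :> R by rewrite divr_gt0.
rewrite -ler_ln ?posrE ?powR_gt0 ?ltr_pwDl //.
rewrite ln_powR; apply: (@le_trans _ _ (a / n.+1%:R)).
  by apply: le_ln1Dx; apply: lt_le_trans an; rewrite ltrN10.
by rewrite ler_wpM2l // inv_le_ln_ratio.
Qed.

(** [growth a n / (n + 1) ^ a] is nondecreasing by [powR_le_affine], and [growth a n / n ^ a] is
    nonincreasing by [one_add_div_le_powR]. The former starts at 1 and lies below the latter, so the
    limit is at least 1. *)
Lemma growth_powR_cvg a : 0 <= a <= 1 ->
  exists2 zeta : R, 0 < zeta & growth a n / n%:R `^ a @[n --> \oo] --> zeta.
Proof.
move=> a01; have /andP[a0 a1] := a01.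
pose v n : R := growth a n / n.+1%:R `^ a.
pose w n : R := growth a n / n%:R `^ a.
have pos n : 0 < n.+1%:R `^ a by rewrite powR_gt0.
have vnd n : v n <= v n.+1.
  rewrite /v growthS ler_pdivlMr // mulrAC ler_pdivrMr // -!mulrA.
  rewrite ler_wpM2l ?(ltW (growth_gt0 _ _)) //.
  have -> : n.+2%:R = n.+1%:R * (1 + n.+1%:R^-1) :> R.
    by rewrite mulrDr mulr1 divff // -natr1.
  rewrite powRM ?addr_ge0 // mulrC ler_wpM2r ?powR_ge0 //.
  exact: powR_le_affine.
have wni n : (0 < n)%N -> w n.+1 <= w n.
  move=> n0; have n0' : 0 < n%:R :> R by rewrite ltr0n.
  have pn : 0 < n%:R `^ a :> R by rewrite powR_gt0.
  rewrite /w growthS ler_pdivlMr // mulrAC ler_pdivrMr // -!mulrA.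
  rewrite ler_wpM2l ?(ltW (growth_gt0 _ _)) //.
  rewrite [leRHS](_ : _ = (n.+1%:R / n%:R) `^ a * n%:R `^ a); last first.
    by rewrite -powRM ?divr_ge0 // divfK ?gt_eqF.
  by rewrite ler_wpM2r ?powR_ge0 // one_add_div_le_powR.
have w1 n : (0 < n)%N -> 1 <= w n.
  move=> n0; have n0' : 0 < n%:R :> R by rewrite ltr0n.
  have v0 : v 0%N = 1 by rewrite /v /growth big_ord0 powR1 divr1.
  have vn : v 0%N <= v n by move/nondecreasing_seqP: vnd; apply.
  rewrite -v0 (le_trans vn) // ler_wpM2l ?(ltW (growth_gt0 _ _)) //.
  by rewrite lef_pV2 ?posrE ?powR_gt0 // ge0_ler_powR ?nnegrE ?ler_nat.
have [n n0|n n0|l hl _] := @nondecreasing_from1_cvg _ (fun n => - w n) (- 1).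
- by rewrite lerN2 wni.
- by rewrite lerN2 w1.
have wl : w n @[n --> \oo] --> - l.
  apply: cvg_trans (cvgN hl); apply: near_eq_cvg; apply: nearW => n.
  by rewrite fctE opprK.
exists (- l) => //; apply: lt_le_trans ltr01 _; apply: (cvgr_to_ge wl).
by exists 1%N => // n /= n0; exact: w1.
Qed.

Lemma powRN_cvg0 (e : R) : 0 < e -> n%:R `^ (- e) @[n --> \oo] --> (0 : R).
Proof.
move=> e0; apply/cvgr0Pnorm_le => eps eps0.
near=> n.
have n0 : 0 < n%:R :> R by rewrite ltr0n; near: n; exists 1%N.
rewrite ger0_norm ?powR_ge0 // powRN -[leRHS]invrK.
rewrite lef_pV2 ?posrE ?powR_gt0 ?invr_gt0 //.
have -> : eps^-1 = (eps^-1 `^ e^-1) `^ e.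
  by rewrite -powRrM mulVf ?powRr1 ?gt_eqF // invr_ge0 ltW.
rewrite ge0_ler_powR ?nnegrE ?powR_ge0 // ?(ltW e0) //.
by near: n; exact: nbhs_infty_ger.
Unshelve. all: by end_near. Qed.

Lemma growth_ratio_cvg0 (s a : R) : 0 <= s -> s < a -> a <= 1 ->
  growth s n / growth a n @[n --> \oo] --> (0 : R).
Proof.
move=> s0 sa a1.
have [|x x0 hx] := @growth_powR_cvg s.
  by rewrite s0 (ltW (lt_le_trans sa a1)).
have [|y y0 hy] := @growth_powR_cvg a.
  by rewrite a1 (ltW (le_lt_trans s0 sa)).
have sa0 : 0 < a - s by rewrite subr_gt0.
have := cvgM (cvgM hx (cvgV (lt0r_neq0 y0) hy)) (powRN_cvg0 sa0).
rewrite mulr0 => H; apply: cvg_trans (H _ _ _); apply: near_eq_cvg.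
exists 1%N => // n /= n0.
have n0' : n%:R != 0 :> R by rewrite pnatr_eq0 -lt0n.
rewrite opprB powRB ?n0' ?implybT // invf_div.
have g0 := growth_gt0 n (le_trans s0 (ltW sa)).
by field; rewrite gt_eqF //= !powR_eq0 !negb_and !n0'.
Qed.

(** The case opposite to [perturbed_growth_dominated]: the homogeneous solution outgrows the source.
    The sign of the limit is left open, so positivity needs a separate argument. *)
Lemma perturbed_growth_cvg a s C h : 0 <= s -> s < a -> a <= 1 ->
  (forall n, (0 < n)%N ->
     `|h n.+1 - h n * (1 + a / n.+1%:R)| <= C * growth s n / n.+1%:R) ->
  exists b : R, h n / growth a n @[n --> \oo] --> b.
Proof.
move=> s0 sa a1 hh; have as0 : 0 < a - s by rewrite subr_gt0.
have a0 : 0 <= a by exact: le_trans (ltW sa).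
(* [K growth s] absorbs the perturbation: [h - K growth s] and
   [h + K growth s], divided by [growth a], are monotone in opposite senses. *)
pose K := C / (a - s).
have step n : K * growth s n.+1 =
    K * growth s n * (1 + a / n.+1%:R) - C * growth s n / n.+1%:R.
  rewrite growthS /K; field.
  by rewrite gt_eqF //= gt_eqF // ltr_wpDr.
pose v n := h n - K * growth s n; pose w n := h n + K * growth s n.
have vnd n : (0 < n)%N -> v n / growth a n <= v n.+1 / growth a n.+1.
  move=> n0; apply: growth_ratio_ge => //; rewrite /v step.
  have := hh _ n0; rewrite ler_norml => /andP[h1 _].
  by move: h1; set q := 1 + _; set e := C * _ / _; rewrite mulrBl; lra.
have wni n : (0 < n)%N -> w n.+1 / growth a n.+1 <= w n / growth a n.
  move=> n0; apply: growth_ratio_le => //; rewrite /w step.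
  have := hh _ n0; rewrite ler_norml => /andP[_ h1].
  by move: h1; set q := 1 + _; set e := C * _ / _; rewrite mulrDl; lra.
have C0 : 0 <= C.
  have := le_trans (normr_ge0 _) (hh 1%N isT).
  by rewrite pmulr_lge0 ?invr_gt0 // pmulr_lge0 // growth_gt0.
have [//|n n0|b hb _] :=
  @nondecreasing_from1_cvg _ (fun n => v n / growth a n) (w 1%N / growth a 1).
  apply: le_trans (_ : w n / growth a n <= _); last first.
    by apply: (nonincreasing_from1 (u := fun n => w n / growth a n)).
  rewrite ler_pM2r ?invr_gt0 ?growth_gt0 // /v /w.
  have : 0 <= K * growth s n.
    by rewrite mulr_ge0 ?divr_ge0 ?(ltW as0) ?(ltW (growth_gt0 _ _)).
  lra.
exists b; rewrite -[b]addr0.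
have := cvgD hb (cvgM (cvg_cst K) (growth_ratio_cvg0 s0 sa a1)).
rewrite mulr0 => H; apply: cvg_trans (H _ _ _); apply: near_eq_cvg; near=> n.
by rewrite fctE /v /= mulrBl -mulrA subrK.
Unshelve. all: by end_near. Qed.

End powers.

(** * Harmonic sums, the origin of the logarithm at [p = 1 / 2] *)

Section harmonic_sums.
Context {R : realType}.

Definition harmonic_sum (n : nat) : R := \sum_(i < n) i.+1%:R^-1.

Lemma harmonic_sumS n : harmonic_sum n.+1 = harmonic_sum n + n.+1%:R^-1.
Proof. by rewrite /harmonic_sum big_ord_recr. Qed.

Lemma ln_leq_harmonic_sum n : ln n.+1%:R <= harmonic_sum n :> R.
Proof.
elim: n => [|n IH]; first by rewrite /harmonic_sum big_ord0 ln1.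
have e : ln n.+2%:R = ln n.+1%:R + ln (1 + n.+1%:R^-1) :> R.
  rewrite -lnM ?posrE ?ltr0n ?ltr_pwDl //; congr ln.
  by rewrite mulrDr mulr1 divff // -natr1.
rewrite e harmonic_sumS lerD // le_ln1Dx //.
by apply: lt_le_trans (_ : 0 <= _); rewrite ?ltrN10 ?invr_ge0.
Qed.

Lemma harmonic_sum_le_ln n : (0 < n)%N -> harmonic_sum n <= 1 + ln n%:R :> R.
Proof.
case: n => // n _; elim: n => [|n IH].
  by rewrite /harmonic_sum big_ord1 ln1 addr0 invr1.
have e : ln n.+2%:R = ln n.+1%:R + ln (n.+2%:R / n.+1%:R) :> R.
  by rewrite ln_div ?posrE ?ltr0n // addrCA subrr addr0.
by rewrite harmonic_sumS e addrA lerD // inv_le_ln_ratio.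
Qed.

Lemma ln_nat_cvgy : ln n%:R @[n --> \oo] --> (+oo : set_system R).
Proof.
apply/cvgryPge => M; near=> n.
rewrite -[leLHS]expRK ler_ln ?posrE ?expR_gt0 //.
  by near: n; exact: nbhs_infty_ger.
by rewrite ltr0n; near: n; exists 1%N.
Unshelve. all: by end_near. Qed.

Lemma inv_ln_nat_cvg0 : (ln n%:R)^-1 @[n --> \oo] --> (0 : R).
Proof.
apply/cvgr0Pnorm_le => e e0; near=> n.
have le_ln : e^-1 <= ln n%:R.
  by near: n; have /cvgryPge := ln_nat_cvgy; apply.
have ln0 : 0 < ln n%:R :> R by rewrite (lt_le_trans _ le_ln) ?invr_gt0.
by rewrite ger0_norm ?invr_ge0 ?(ltW ln0) // -[e]invrK lef_pV2 ?posrE ?invr_gt0.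
Unshelve. all: by end_near. Qed.

Lemma harmonic_sum_ln_cvg1 : harmonic_sum n / ln n%:R @[n --> \oo] --> (1 : R).
Proof.
apply: (@squeeze_cvgr _ _ _ _ (fun=> 1) (fun n => 1 + (ln n%:R)^-1)).
- near=> n.
  have n1 : (1 < n)%N by near: n; exists 2%N.
  have ln0 : 0 < ln n%:R :> R by rewrite ln_gt0 // ltr1n.
  have n0 : (0 < n)%N by exact: ltnW.
  rewrite ler_pdivlMr // ler_pdivrMr // mul1r mulrDl mul1r mulVf ?gt_eqF //.
  rewrite [ln _ + 1]addrC harmonic_sum_le_ln // andbT.
  apply: le_trans (ln_leq_harmonic_sum n); rewrite ler_ln ?posrE ?ltr0n //.
  by rewrite ler_nat.
- exact: cvg_cst.
- rewrite -[X in _ --> X]addr0; apply: cvgD; first exact: cvg_cst.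
  exact: inv_ln_nat_cvg0.
Unshelve. all: by end_near. Qed.

(** Each factor of [growth s] adds at least [s / (i + 1)], since the product stays above 1. Hence a
    small positive exponent absorbs a harmonic sum. *)
Lemma harmonic_sum_growth (s : R) n : 0 <= s <= 1 -> s * harmonic_sum n <= growth s n.
Proof.
move=> /andP[s0 s1]; elim: n => [|n IH].
  by rewrite /harmonic_sum big_ord0 mulr0 ltW // growth_gt0.
rewrite harmonic_sumS growthS !mulrDr mulr1 lerD // ler_peMl ?growth_ge1 //.
by rewrite divr_ge0.
Qed.

End harmonic_sums.

Lemma growth_dominated_cvg0 {R : realType} (s q K : R) (h : nat -> R) :
  0 <= s -> s < q -> q <= 1 ->
  (forall n, (0 < n)%N -> `|h n| <= K * growth s n) ->
  h n / n%:R `^ q @[n --> \oo] --> (0 : R).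
Proof.
move=> s0 sq q1 hK; have q0 := le_lt_trans s0 sq.
have [|z z0 hz] := @growth_powR_cvg _ q; first by rewrite q1 ltW.
apply: norm_cvg0.
apply: (@squeeze_cvgr _ _ _ _ (fun=> 0)
  (fun n => K * (growth s n / growth q n * (growth q n / n%:R `^ q)))).
- near=> n.
  have n0 : (0 < n)%N by near: n; exists 1%N.
  rewrite normr_ge0 /= normrM [X in _ <= K * X]mulrA divfK ?gt_eqF ?growth_gt0 ?(ltW q0) //.
  rewrite [X in _ * X <= _]ger0_norm ?invr_ge0 ?powR_ge0 // mulrA.
  by rewrite ler_wpM2r ?invr_ge0 ?powR_ge0 // hK.
- exact: cvg_cst.
- rewrite (_ : 0 = K * (0 * z)); last by rewrite mul0r mulr0.
  apply: cvgM; first exact: cvg_cst.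
  by apply: cvgM => //; exact: growth_ratio_cvg0.
Unshelve. all: by end_near. Qed.

(** * Asymptotics from the recursions for the means *)

Section asymptotics.
Context {R : realType}.
(** [l], [a] and [u] stand for the means of [L], [A] and [Q / L ^ 2]; the hypotheses are established
    later on permutations. In [a_ge] the number [t] is free, to be optimised. *)
Variables (p : R) (l a u : nat -> R).
Hypothesis p01 : 0 < p <= 1.
Hypothesis l_step : forall n, (0 < n)%N ->
  l n * (1 + p / n.+1%:R) <= l n.+1 <= l n * (1 + p / n.+1%:R) + 1 / n.+1%:R.
Hypothesis l_bounds : forall n, (0 < n)%N -> 1 <= l n <= n%:R.
Hypothesis u_step : forall (d : R) n, (0 < n)%N -> d <= 5 / 9 -> d <= 21 / 16 * p ->
  u n.+1 <= u n * (1 + (1 - d) / n.+1%:R) + (1 / 2) / n.+1%:R.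
Hypothesis a_step : forall n, (0 < n)%N ->
  `|a n.+1 - (a n * (1 + (1 - p) / n.+1%:R) + p ^+ 2 / 2 * l n / n.+1%:R)|
    <= (3 / 2 + u n) / n.+1%:R.
Hypothesis a_ge : forall n (t : R), (0 < n)%N -> 0 <= t ->
  t * Num.sqrt n%:R - t ^+ 2 * l n <= a n.

Let p0 : 0 < p. Proof. by case/andP: p01. Qed.
Let p1 : p <= 1. Proof. by case/andP: p01. Qed.

Lemma num_growth_bound :
  exists2 K : R, 0 < K & forall n, (0 < n)%N -> l n <= K * growth p n.
Proof.
have [|K K0 HK] := @affine_growth_bound _ p 1 l p0.
  by move=> n n0; have /andP[] := l_step n0.
exists (K + 1); first by rewrite ltr_wpDl.
move=> n n0; apply: le_trans (HK n n0) _.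
rewrite lerBlDr mulrDl mul1r -addrA lerDl addr_ge0 ?divr_ge0 ?(ltW p0) //.
by rewrite ltW // growth_gt0 // ltW.
Qed.

Lemma num_growth_cvg : exists2 c : R, 0 < c & l n / growth p n @[n --> \oo] --> c.
Proof.
have [K K0 HK] := num_growth_bound.
have [n n0|n n0|c hc c_ge] := @nondecreasing_from1_cvg _ (fun n => l n / growth p n) K.
- by apply: growth_ratio_ge; [exact: ltW|have /andP[] := l_step n0].
- by rewrite ler_pdivrMr ?HK // growth_gt0 // ltW.
exists c => //; apply: lt_le_trans (c_ge 1%N isT).
have /andP[l1 _] := l_bounds (ltnSn 0).
by rewrite divr_gt0 ?(lt_le_trans _ l1) // growth_gt0 // ltW.
Qed.

Lemma num_powR_cvg : exists2 c : R, 0 < c & l n / n%:R `^ p @[n --> \oo] --> c.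
Proof.
have [c c0 hc] := num_growth_cvg.
have [|z z0 hz] := @growth_powR_cvg _ p; first by rewrite p1 ltW.
exists (c * z); first exact: mulr_gt0.
apply: cvg_trans (cvgM hc hz); apply: near_eq_cvg; apply: nearW => n /=.
by rewrite /= mulrA divfK // gt_eqF // growth_gt0 // ltW.
Qed.

(** The error in [a_step] must grow more slowly than the leading term. The largest admissible [d]
    exceeds [1 / 2] if [p >= 1 / 2], and exceeds [p] if [p < 1 / 2], because [5 / 9 > 1 / 2] and
    [21 / 16 > 1]. *)
Lemma weighted_growth_bound : exists s : R,
  [/\ 0 < s <= 1, (1 / 2 <= p -> s < 1 / 2), (p < 1 / 2 -> s < 1 - p) &
    exists2 K : R, 0 <= K & forall n, (0 < n)%N -> 3 / 2 + u n <= K * growth s n].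
Proof.
pose d : R := Num.min (5 / 9) (21 / 16 * p).
have d1 : d <= 5 / 9 by rewrite ge_min lexx.
have d2 : d <= 21 / 16 * p by rewrite ge_min lexx orbT.
have d0 : 0 < d by rewrite lt_min; apply/andP; split; [lra|have := p0; lra].
have [||K K0 HK] := @affine_growth_bound _ (1 - d) (1 / 2) u; first by lra.
  by move=> n n0; exact: u_step.
exists (1 - d); split.
- by apply/andP; split; lra.
- move=> hp; have : 1 / 2 < d by rewrite lt_min; apply/andP; split; lra.
  lra.
- move=> hp; have p0' := p0.
  have : p < d by rewrite lt_min; apply/andP; split; lra.
  lra.
exists (K + 3 / 2) => [|n n0]; [lra | rewrite mulrDl].
have g1 : 1 <= growth (1 - d) n by apply: growth_ge1; lra.
have := HK n n0; have : 0 <= 1 / 2 / (1 - d) by apply: divr_ge0; lra.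
lra.
Qed.

Lemma avg_cvg_gt_half (c : R) : 1 / 2 < p -> l n / n%:R `^ p @[n --> \oo] --> c ->
  a n / n%:R `^ p @[n --> \oo] --> p ^+ 2 / (2 * (2 * p - 1)) * c.
Proof.
move=> hp hc; have [s [/andP[s0 s1] sp _ [K K0 HK]]] := weighted_growth_bound.
have {}sp := sp (ltW hp).
(* [k] is chosen so that the driving terms [l n / n.+1] cancel in [a - k l]. *)
pose k := p ^+ 2 / (2 * (2 * p - 1)).
have q0 : 0 < 2 * p - 1 by lra.
have k0 : 0 <= k by rewrite divr_ge0 ?sqr_ge0 // mulr_ge0 // ltW.
have kE : k * (2 * p - 1) = p ^+ 2 / 2 by rewrite /k; field; rewrite gt_eqF.
pose h n := a n - k * l n.
(* The exponent [1 / 2] lies above both [1 - p] and the error exponent [s], and still below [p]. *)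
have [||n n0|M HM] := @perturbed_growth_dominated _ (1 - p) (1 / 2) (K + k) h.
- by rewrite subr_ge0.
- lra.
- have i0 : 0 <= n.+1%:R^-1 :> R by rewrite invr_ge0.
  apply: le_trans (_ : (3 / 2 + u n) / n.+1%:R + k / n.+1%:R <= _).
    have := a_step n0; have /andP[] := l_step n0; rewrite /h.
    set X := a n.+1 - _ => l1 l2 aX.
    rewrite (_ : _ - _ = X - k * (l n.+1 - l n * (1 + p / n.+1%:R))); last first.
      rewrite /X -kE; ring.
    apply: le_trans (ler_normB _ _) _; apply: lerD => //.
    rewrite normrM (ger0_norm k0) ler_wpM2l // ger0_norm ?subr_ge0 //.
    by rewrite lerBlDl; rewrite mul1r in l2.
  rewrite -mulrDl ler_wpM2r // [leRHS]mulrDl.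
  have g1 : growth s n <= growth (1 / 2) n by apply: ler_growth; lra.
  have g2 : 1 <= growth (1 / 2) n :> R by apply: growth_ge1; lra.
  apply: lerD; last by rewrite ler_peMr.
  by apply: le_trans (HK n n0) _; rewrite ler_wpM2l.
have hh := growth_dominated_cvg0 _ hp p1 HM.
rewrite -[X in _ --> X]addr0.
apply: cvg_trans (cvgD (cvgM (cvg_cst k) hc) (hh _)); last by lra.
apply: near_eq_cvg; apply: nearW => n /=.
by rewrite fctE /= /h mulrBl mulrA addrC subrK.
Qed.

Lemma avg_cvg_half (c : R) : p = 1 / 2 -> l n / n%:R `^ p @[n --> \oo] --> c ->
  a n / (n%:R `^ p * ln n%:R) @[n --> \oo] --> c / 8.
Proof.
move=> hp hc; have [s [/andP[s0 s1] sp _ [K K0 HK]]] := weighted_growth_bound.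
have {}sp : s < p by rewrite hp; apply: sp; rewrite hp.
(* As for [1 / 2 < p], [l * harmonic_sum / 8] cancels the driving terms. *)
pose h n := a n - l n * harmonic_sum n / 8.
have [||//|n n0|b hb] := @perturbed_growth_cvg _ p s (K + (2 + s^-1) / 8) h.
- exact: ltW.
- by [].
- have := a_step n0; have /andP[] := l_step n0; rewrite /h harmonic_sumS.
  have i0 : 0 < n.+1%:R^-1 :> R by rewrite invr_gt0.
  have i1 : n.+1%:R^-1 <= 1 :> R by rewrite invf_le1 // ler1n.
  have := HK n n0.
  have := growth_ge1 n (ltW s0).
  have : harmonic_sum n <= s^-1 * growth s n.
    by rewrite -ler_pdivrMl ?invr_gt0 // invrK harmonic_sum_growth // s1 ltW.
  have : 0 <= harmonic_sum n :> R by apply: sumr_ge0 => i _; rewrite invr_ge0.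
  have /andP[l1 ln] := l_bounds n0.
  have : l n * n.+1%:R^-1 <= 1.
    by rewrite ler_pdivrMr // mul1r (le_trans ln) // ler_nat.
  rewrite hp; move: (n.+1%:R^-1) i0 i1 (harmonic_sum n) (growth s n) => i i0 i1 H g.
  move=> li H0 HE g1 ug l2 l3 ha.
  move: ha; set X := a n.+1 - _ => ha.
  pose e := l n.+1 - l n * (1 + 1 / 2 * i).
  have e0 : 0 <= e by rewrite subr_ge0.
  have e1 : e <= i by rewrite /e; lra.
  (* In the expansion of [l * harmonic_sum] at [n.+1], the term [l n * i / 8] cancels the driving
     term, as [p ^ 2 / 2 = 1 / 8]. Left over are the defect [e] of the recursion for [l] and a
     second-order term. *)
  rewrite (_ : _ - _ = X - (e * (H + i) + l n * i * i / 2) / 8); last first.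
    by rewrite /X /e; field.
  apply: le_trans (ler_normB _ _) _.
  rewrite [X in _ + X]ger0_norm; last first.
    have i0' := ltW i0; have l0 : 0 <= l n by exact: le_trans ler01 l1.
    apply: divr_ge0 => //; apply: addr_ge0; first by rewrite mulr_ge0 // addr_ge0.
    by rewrite divr_ge0 // !mulr_ge0.
  have B1 : e * (H + i) <= i * (s^-1 * g + 1).
    by apply: ler_pM => //; [rewrite addr_ge0 // ltW|exact: lerD].
  have B2 : l n * i * i / 2 <= i by nra.
  have B3 : `|X| <= K * g * i.
    by apply: le_trans ha _; rewrite ler_wpM2r // ltW.
  have B4 : i <= i * g by rewrite ler_peMr // ltW.
  rewrite (_ : (K + (2 + s^-1) / 8) * g * i =
    K * g * i + (i * (s^-1 * g) + 2 * (i * g)) / 8); last by ring.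
  lra.
have [|z z0 hz] := @growth_powR_cvg _ p; first by rewrite p1 ltW.
(* The main term tends to [c / 8]; [h] is at most of order [n ^ p], so division by the logarithm
   kills it. *)
have := cvgD (cvgM (cvgM hc harmonic_sum_ln_cvg1) (cvg_cst (8^-1 : R)))
   (cvgM (cvgM hb hz) inv_ln_nat_cvg0).
rewrite mulr1 mulr0 addr0 => H; apply: cvg_trans (H _ _ _ _ _ _); apply: near_eq_cvg.
apply: nearW => n; rewrite fctE /= /h.
have g0 : growth p n != 0 by rewrite gt_eqF // growth_gt0 // ltW.
rewrite [X in _ + X / _]mulrA divfK // invfM; ring.
Qed.

Lemma avg_cvg_lt_half (c : R) : p < 1 / 2 -> 0 < c ->
  l n / n%:R `^ p @[n --> \oo] --> c ->
  exists2 b : R, 0 < b & a n / n%:R `^ (1 - p) @[n --> \oo] --> b.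
Proof.
move=> hp c0 hc; have [s [/andP[s0 s1] _ sp [K K0 HK]]] := weighted_growth_bound.
have {}sp := sp hp; have [K' K'0 HK'] := num_growth_bound.
(* [m] covers both sources, the error of exponent [s] and the driving term of exponent [p], and
   stays below [1 - p]. *)
pose m := Num.max s p.
have m0 : 0 <= m by rewrite le_max (ltW s0).
have m1 : m < 1 - p by rewrite gt_max sp /=; lra.
have q01 : 0 <= 1 - p <= 1 by have := p0; lra.
have /andP[q0 q1] := q01.
have [//|//|//|n n0|b hb] :=
  @perturbed_growth_cvg _ (1 - p) m (K + p ^+ 2 / 2 * K') a.
  have i0 : 0 <= n.+1%:R^-1 :> R by rewrite invr_ge0.
  have pK0 : 0 <= p ^+ 2 / 2 by rewrite divr_ge0 // sqr_ge0.
  have /andP[ln1 _] := l_bounds n0.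
  apply: le_trans (_ : (3 / 2 + u n) / n.+1%:R + p ^+ 2 / 2 * l n / n.+1%:R <= _).
    rewrite -(subrK (p ^+ 2 / 2 * l n / n.+1%:R) (_ - _)).
    apply: le_trans (ler_normD _ _) _; apply: lerD.
      by rewrite -addrA -opprD a_step.
    by rewrite ger0_norm // mulr_ge0 // mulr_ge0 // (le_trans ler01 ln1).
  rewrite -mulrDl ler_wpM2r // [leRHS]mulrDl -[p ^+ 2 / 2 * K' * _]mulrA.
  apply: lerD.
    apply: le_trans (HK n n0) _; rewrite ler_wpM2l //.
    by apply: ler_growth; rewrite ?le_max ?lexx // ltW.
  rewrite ler_wpM2l //; apply: le_trans (HK' n n0) _.
  rewrite ler_wpM2l ?(ltW K'0) //.
  by apply: ler_growth; rewrite ?le_max ?lexx ?orbT // ltW.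
have [//|z z0 hz] := @growth_powR_cvg _ (1 - p).
have hA : a n / n%:R `^ (1 - p) @[n --> \oo] --> b * z.
  apply: cvg_trans (cvgM hb hz); apply: near_eq_cvg; apply: nearW => n /=.
  by rewrite mulrA divfK // gt_eqF // growth_gt0.
exists (b * z) => //; apply: (@lt_le_trans _ _ (1 / (4 * c))).
  by rewrite divr_gt0 // mulr_gt0.
have hB : 1 / (2 * c) - 1 / (4 * c ^+ 2) * (l n / n%:R `^ p) @[n --> \oo]
    --> 1 / (4 * c).
  rewrite (_ : 1 / (4 * c) = 1 / (2 * c) - 1 / (4 * c ^+ 2) * c); last first.
    by field; rewrite gt_eqF.
  by apply: cvgB; [exact: cvg_cst | apply: cvgM => //; exact: cvg_cst].
apply: (ler_cvg_to hB hA); near=> n.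
have n0 : (0 < n)%N by near: n; exists 1%N.
have n0' : 0 < n%:R :> R by rewrite ltr0n.
have w0 : 0 < n%:R `^ p by rewrite powR_gt0.
have -> : n%:R `^ (1 - p) = n%:R / n%:R `^ p.
  by rewrite powRB ?powRr1 // ?(gt_eqF n0') ?implybT.
rewrite ler_pdivlMr ?divr_gt0 //.
(* This [t] maximises [t * sqrt n - t ^ 2 * c * n ^ p], the lower bound with [l n] replaced by its
   asymptotic value; the maximum is [n ^ (1 - p) / (4 * c)]. *)
apply: le_trans (a_ge (t := Num.sqrt n%:R / n%:R `^ p / (2 * c)) n0 _); last first.
  by rewrite !divr_ge0 ?sqrtr_ge0 ?powR_ge0 // mulr_ge0 // ltW.
have sn : Num.sqrt n%:R ^+ 2 = n%:R :> R by rewrite sqr_sqrtr.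
move: (n%:R `^ p) w0 (Num.sqrt _) sn => v v0 w <-.
rewrite le_eqVlt; apply/orP; left; apply/eqP; field.
by rewrite !gt_eqF.
Unshelve. all: by end_near. Qed.

Lemma avg_num_asymptotics : exists c b : R,
  [/\ 0 < b, l n / n%:R `^ p @[n --> \oo] --> c,
      a n / a_norm p n @[n --> \oo] --> b,
      p = 1 / 2 -> b = c / 8
    & 1 / 2 < p -> b = p ^+ 2 / (2 * (2 * p - 1)) * c].
Proof.
have [c c0 hc] := num_powR_cvg; exists c; rewrite /a_norm.
have [hp|hp|hp] := ltgtP p (1 / 2).
- by have [b b0 hb] := avg_cvg_lt_half hp c0 hc; exists b; split => // ?; lra.
- exists (p ^+ 2 / (2 * (2 * p - 1)) * c); split => //; try by move=> ?; lra.
  + by rewrite mulr_gt0 // divr_gt0 ?exprn_gt0 ?mulr_gt0 //; lra.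
  + exact: avg_cvg_gt_half.
- exists (c / 8); split => //; try by move=> ?; lra.
  + by rewrite divr_gt0.
  + by rewrite -hp; exact: avg_cvg_half.
Qed.

End asymptotics.

(** * The rule on a random permutation *)

Section order_statistics.
Context {R : realType}.
Implicit Types (p : R) (x y : nat -> R).

Lemma rank_ext x y n i :
  (forall j, (j < n)%N -> (x j <= x i) = (y j <= y i)) ->
  rank x n i = rank y n i.
Proof. by move=> xy; apply: eq_bigr => j _; rewrite xy. Qed.

Lemma rank_le x n i : (rank x n i <= n)%N.
Proof.
rewrite -[leqRHS](card_ord n) -sum1_card.
by apply: leq_sum => j _; case: (_ <= _).
Qed.

Lemma rank_leE x n i j : (i < n)%N -> (j < n)%N ->
  (rank x n i <= rank x n j)%N = (x i <= x j).
Proof.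
move=> ni nj; have [ij|ji] := leP (x i) (x j).
  apply: leq_sum => k _; case: (leP (x k) (x i)) => // ki.
  by rewrite (le_trans ki ij).
apply/negbTE; rewrite -ltnNge /rank (bigD1 (Ordinal ni)) //=.
rewrite [ltnRHS](bigD1 (Ordinal ni)) //= lexx leNgt ji add0n add1n ltnS.
apply: leq_sum => k _; case: (leP (x k) (x j)) => // kj.
by rewrite (le_trans kj (ltW ji)).
Qed.

Lemma retained_lt p x n i : i \in retained p x n -> (i < n)%N.
Proof.
elim: n => [|n IH] //=; case: ifP => _; last by move=> /IH /ltnW.
by rewrite in_fset1U => /predU1P[->|/IH /ltnW].
Qed.

(** The rule sees values only through their comparisons. This and the next three statements let a
    permutation with the same order replace random values. *)
Lemma retained_ext p x y n :
  (forall i j, (i < n)%N -> (j < n)%N -> (x i <= x j) = (y i <= y j)) ->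
  retained p x n = retained p y n.
Proof.
elim: n => [//|n IH] xy /=.
rewrite IH => [|i j ni nj]; last by rewrite xy // ltnS ltnW.
by rewrite (@rank_ext x y) // => j nj; rewrite xy.
Qed.

Lemma num_retained_ext p x y n :
  (forall i j, (i < n)%N -> (j < n)%N -> (x i <= x j) = (y i <= y j)) ->
  num_retained p x n = num_retained p y n.
Proof. by move=> xy; rewrite /num_retained (retained_ext p xy). Qed.

Lemma sum_ranks_ext p x y n :
  (forall i j, (i < n)%N -> (j < n)%N -> (x i <= x j) = (y i <= y j)) ->
  sum_ranks p x n = sum_ranks p y n.
Proof.
move=> xy; rewrite /sum_ranks (retained_ext p xy) !big_seq.
apply: eq_bigr => i /retained_lt ni; apply: rank_ext => j nj; exact: xy.
Qed.

Lemma avg_rank_ext p x y n :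
  (forall i j, (i < n)%N -> (j < n)%N -> (x i <= x j) = (y i <= y j)) ->
  avg_rank p x n = avg_rank p y n.
Proof.
by move=> xy; rewrite /avg_rank (sum_ranks_ext p xy) (num_retained_ext p xy).
Qed.

(** The absolute value only casts to [nat]: for [0 < p] the ceiling is nonnegative, see
    [ceil_threshold]. *)
Definition threshold p x n : nat :=
  `|Num.ceil (p * (num_retained p x n)%:R)|%N.

(** If [r] items are better than a newcomer, these are the retained items that it pushes up by one
    rank. *)
Definition num_ranked_above p x n (r : nat) : nat :=
  \sum_(i <- retained p x n) (r < rank x n i).

Lemma num_ranked_above_le p x n r :
  (num_ranked_above p x n r <= num_retained p x n)%N.
Proof.
by rewrite /num_retained -sum1_size; apply: leq_sum => i _; exact: leq_b1.
Qed.

(** A retained item of rank [m] is counted for exactly the [m] values [r < m]. Hence a uniform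
    insertion raises the old ranks by [Q / (n + 1)] in total, on average. *)
Lemma sum_num_ranked_above p x n :
  (\sum_(r < n.+1) num_ranked_above p x n r)%N = sum_ranks p x n.
Proof.
rewrite exchange_big; apply: eq_bigr => i _ /=.
have := rank_le x n i; move: (rank x n i) => m mn.
rewrite -(big_mkord xpredT (fun r => nat_of_bool (r < m)%N)).
rewrite (big_cat_nat (n := m)) //=; last exact: leqW.
rewrite [X in (_ + X)%N]big1_seq ?addn0 => [|r]; last first.
  by rewrite mem_index_iota => /andP[_ /andP[mr _]]; rewrite ltnNge mr.
rewrite (eq_big_nat _ _ (F2 := fun=> 1%N)) => [|r /andP[_ ->]] //.
by rewrite sum_nat_const_nat subn0 muln1.
Qed.

Lemma retainedS p x n : (0 < n)%N ->
  retained p x n.+1 =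
  if (rank x n.+1 n)%:Z <= Num.ceil (p * (num_retained p x n)%:R)
  then (n |` retained p x n)%fset else retained p x n.
Proof. by case: n. Qed.

Lemma mem0_retained p x n : (0 < n)%N -> 0%N \in retained p x n.
Proof.
elim: n => [//|[|n] IH] _; first by rewrite /= in_fset1U eqxx.
by rewrite retainedS //; case: ifP => _; rewrite ?in_fset1U IH ?orbT.
Qed.

Lemma num_retained_gt0 p x n : (0 < n)%N -> (0 < num_retained p x n)%N.
Proof.
move=> n0; rewrite cardfs_gt0; apply/fset0Pn; exists 0%N.
exact: mem0_retained.
Qed.

Lemma num_retainedS p x n : (0 < n)%N ->
  num_retained p x n.+1 =
  (num_retained p x n +
   ((rank x n.+1 n)%:Z <= Num.ceil (p * (num_retained p x n)%:R))%R)%N.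
Proof.
move=> n0; rewrite {1}/num_retained retainedS //.
case: ifP => //= _; last by rewrite addn0.
rewrite cardfsU1.
case: (boolP (n \in _)) => [/retained_lt|_]; first by rewrite ltnn.
by rewrite addnC.
Qed.

Lemma sum_ranksS p x n : (0 < n)%N ->
  sum_ranks p x n.+1 =
  (\sum_(i <- retained p x n) rank x n.+1 i +
   ((rank x n.+1 n)%:Z <= Num.ceil (p * (num_retained p x n)%:R))%R * rank x n.+1 n)%N.
Proof.
move=> n0; rewrite {1}/sum_ranks retainedS //.
case: ifP => //= _; last by rewrite addn0.
rewrite big_fsetU1 /=; first by rewrite mul1n addnC.
by apply/negP => /retained_lt; rewrite ltnn.
Qed.

Lemma num_retained_le p x n : (num_retained p x n <= n)%N.
Proof.
elim: n => [|[|n] IH]; first by [].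
  by rewrite /num_retained [retained _ _ _]/= fsetU0 cardfs1.
by rewrite num_retainedS // (leq_trans (leq_add IH (leq_b1 _))) ?addn1.
Qed.

Lemma ceil_threshold p x n : 0 < p ->
  Num.ceil (p * (num_retained p x n)%:R) = threshold p x n.
Proof.
by move=> p0; rewrite /threshold gez0_abs // -(ceil0 R) le_ceil // mulr_ge0 // ltW.
Qed.

Lemma threshold_le p x n : 0 < p <= 1 ->
  (threshold p x n <= num_retained p x n)%N.
Proof.
move=> /andP[p0 p1]; rewrite -lez_nat -ceil_threshold // ceil_le_int -pmulrn.
by rewrite ler_piMl.
Qed.

Lemma threshold_ge p x n : 0 < p ->
  p * (num_retained p x n)%:R <= (threshold p x n)%:R.
Proof.
by move=> p0; rewrite [leRHS]pmulrn -ceil_threshold // ceil_ge.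
Qed.

Lemma threshold_lt p x n : 0 < p ->
  (threshold p x n)%:R < p * (num_retained p x n)%:R + 1.
Proof.
move=> p0; rewrite [ltLHS]pmulrn -ceil_threshold // -ltrBlDr.
by have := ceilB1_lt (p * (num_retained p x n)%:R); rewrite intrB.
Qed.

Lemma threshold_gt0 p x n : 0 < p -> (0 < n)%N -> (0 < threshold p x n)%N.
Proof.
move=> p0 n0; rewrite -(ltr_nat R); apply: lt_le_trans (threshold_ge _ _ p0).
by rewrite mulr_gt0 // ltr0n num_retained_gt0.
Qed.

End order_statistics.

(** * Averages over permutations and the insertion of a new item *)

Section permutation_model.
Context {R : realType}.
Implicit Types (p : R).

(** The value 0 beyond the range is a filler, not one of the [n] items. *)
Definition perm_seq n (s : 'S_n) (i : nat) : R :=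
  if insub i is Some j then (s j)%:R else 0.

Definition perm_mean n (F : (nat -> R) -> R) : R :=
  (n`!%:R)^-1 * \sum_(s : 'S_n) F (perm_seq s).

Lemma perm_seqE n (s : 'S_n) (i : 'I_n) : perm_seq s i = (s i)%:R.
Proof. by rewrite /perm_seq valK. Qed.

Lemma perm_seq_lt n (s : 'S_n) i (ni : (i < n)%N) :
  perm_seq s i = (s (Ordinal ni))%:R.
Proof. by rewrite -perm_seqE. Qed.

Lemma rank_perm_seq n (s : 'S_n) i : (i < n)%N ->
  (rank (perm_seq s) n i)%:R = perm_seq s i + 1.
Proof.
move=> ni; rewrite perm_seq_lt natr1; congr _%:R; rewrite /rank.
under eq_bigr do rewrite !perm_seqE (perm_seq_lt _ ni) ler_nat.
move: (s _) => k; rewrite (reindex_inj (@perm_inj _ (s^-1)%g)) /=.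
under eq_bigr do rewrite permKV.
rewrite -(big_mkord xpredT (fun j => nat_of_bool (j <= k)%N)).
rewrite (big_cat_nat (n := k.+1)) //=.
rewrite [X in (_ + X)%N]big1_seq ?addn0 => [|r]; last first.
  by rewrite mem_index_iota => /andP[_ /andP[mr _]]; rewrite leqNgt mr.
rewrite (eq_big_nat _ _ (F2 := fun=> 1%N)) => [|r /andP[_]].
  by rewrite sum_nat_const_nat subn0 muln1.
by rewrite ltnS => ->.
Qed.

(** Inserting a last value [r] into [t] is injective in the pair, hence bijective because
    [(n + 1)! = (n + 1) * n!]. *)
Lemma sum_perm_lift n (G : 'S_n.+1 -> R) :
  \sum_(s : 'S_n.+1) G s =
  \sum_(t : 'S_n) \sum_(r < n.+1) G (lift_perm ord_max r t).
Proof.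
rewrite pair_bigA /=.
rewrite (reindex (fun q : 'S_n * 'I_n.+1 => lift_perm ord_max q.2 q.1)) //.
apply: onW_bij; apply: inj_card_bij; last first.
  by rewrite card_prod !card_Sn card_ord factS mulnC.
move=> [t r] [t' r'] /= e.
have er : r = r'.
  by have := congr1 (fun s : 'S_n.+1 => s ord_max) e; rewrite !lift_perm_id.
congr pair => //; apply/permP => i; subst r'.
have := congr1 (fun s : 'S_n.+1 => s (lift ord_max i)) e.
by rewrite !lift_perm_lift => /lift_inj.
Qed.

(** The rank of the last item is uniform and independent of the order of its predecessors. *)
Lemma perm_mean_lift n (F : (nat -> R) -> R) (G : (nat -> R) -> nat -> R) :
  (forall (t : 'S_n) (r : 'I_n.+1),
     F (perm_seq (lift_perm ord_max r t)) = G (perm_seq t) r) ->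
  perm_mean n.+1 F = perm_mean n (fun x => (\sum_(r < n.+1) G x r) / n.+1%:R).
Proof.
move=> FG; rewrite /perm_mean sum_perm_lift factS natrM invfM -mulrA mulrCA.
congr (_ * _); rewrite mulr_sumr; apply: eq_bigr => t _.
by rewrite mulrC; congr (_ * _); apply: eq_bigr => r _.
Qed.

Lemma eq_perm_mean n (F G : (nat -> R) -> R) :
  (forall s : 'S_n, F (perm_seq s) = G (perm_seq s)) ->
  perm_mean n F = perm_mean n G.
Proof. by move=> FG; congr (_ * _); apply: eq_bigr => s _. Qed.

Lemma le_perm_mean n (F G : (nat -> R) -> R) :
  (forall s : 'S_n, F (perm_seq s) <= G (perm_seq s)) ->
  perm_mean n F <= perm_mean n G.
Proof.
by move=> FG; apply: ler_wpM2l; [rewrite invr_ge0 | apply: ler_sum => s _].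
Qed.

Lemma normr_perm_mean_le n (F G : (nat -> R) -> R) :
  (forall s : 'S_n, `|F (perm_seq s)| <= G (perm_seq s)) ->
  `|perm_mean n F| <= perm_mean n G.
Proof.
move=> FG; rewrite /perm_mean normrM ger0_norm ?invr_ge0 //.
apply: ler_wpM2l; first by rewrite invr_ge0.
by apply: le_trans (ler_norm_sum _ _ _) _; apply: ler_sum => s _.
Qed.

Lemma perm_mean_cst n c : perm_mean n (fun=> c) = c.
Proof.
rewrite /perm_mean sumr_const card_Sn -[c *+ _]mulr_natl mulKf //.
Qed.

Lemma perm_meanD n (F G : (nat -> R) -> R) :
  perm_mean n (fun x => F x + G x) = perm_mean n F + perm_mean n G.
Proof. by rewrite /perm_mean big_split mulrDr. Qed.

Lemma perm_meanZ n c (F : (nat -> R) -> R) :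
  perm_mean n (fun x => c * F x) = c * perm_mean n F.
Proof. by rewrite /perm_mean -mulr_sumr mulrCA. Qed.

Lemma sum_ord_lt n k (f : nat -> R) : (k <= n)%N ->
  \sum_(r < n) (r < k)%N%:R * f r = \sum_(r < k) f r.
Proof.
move=> kn; rewrite -(big_mkord xpredT (fun r => (r < k)%N%:R * f r)).
rewrite -(big_mkord xpredT f).
rewrite (big_cat_nat (n := k)) //=.
rewrite [X in _ + X]big1_seq ?addr0 => [|r]; last first.
  by rewrite mem_index_iota => /andP[_ /andP[kr _]]; rewrite ltnNge kr mul0r.
by apply: eq_big_nat => r /andP[_ ->]; rewrite mul1r.
Qed.

Lemma sum_succ (k : nat) : \sum_(r < k) r.+1%:R = k%:R * (k%:R + 1) / 2 :> R.
Proof.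
elim: k => [|k IH]; first by rewrite big_ord0 !mul0r.
by rewrite big_ord_recr /= IH -natr1; field.
Qed.

Section lift.
Context (n : nat) (t : 'S_n) (r : 'I_n.+1).
Let x := perm_seq t.
Let y := perm_seq (lift_perm ord_max r t).

(** [lift] makes room for the value [r] by shifting the values from [r] on. *)
Lemma perm_seq_lift i : (i < n)%N -> y i = x i + (r%:R <= x i)%R%:R.
Proof.
move=> ni; have ni' : (i < n.+1)%N by exact: leqW.
rewrite /x /y (perm_seq_lt _ ni') (perm_seq_lt _ ni).
have -> : Ordinal ni' = lift ord_max (Ordinal ni).
  by apply: val_inj => /=; rewrite /bump leqNgt ni.
by rewrite lift_perm_lift /= /bump ler_nat -natrD addnC.
Qed.

Lemma perm_seq_lift_max : y n = r%:R.
Proof.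
rewrite /y (perm_seq_lt _ (ltnSn n)) (_ : Ordinal _ = ord_max) ?lift_perm_id //.
Qed.

Lemma perm_seq_lift_le i j : (i < n)%N -> (j < n)%N ->
  (y i <= y j) = (x i <= x j).
Proof.
move=> ni nj; rewrite !perm_seq_lift // /x (perm_seq_lt _ ni) (perm_seq_lt _ nj).
rewrite !ler_nat -!natrD ler_nat.
by do 2 case: leqP; lia.
Qed.

End lift.

Variable p : R.
Hypothesis p01 : 0 < p <= 1.

(** The newcomer has value [r] but rank [r + 1], whence the strict inequality. *)
Lemma num_retained_lift n (t : 'S_n) (r : 'I_n.+1) : (0 < n)%N ->
  let x := perm_seq t in let y := perm_seq (lift_perm ord_max r t) in
  num_retained p y n.+1 = (num_retained p x n + (r < threshold p x n))%N.
Proof.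
move=> n0 x y; have /andP[p0 p1] := p01.
have yx := fun i j ni nj => perm_seq_lift_le t r (i := i) (j := j) ni nj.
have Ly : num_retained p y n = num_retained p x n by exact: num_retained_ext.
have rk : rank y n.+1 n = r.+1.
  by apply/eqP; rewrite -(eqr_nat R) rank_perm_seq // perm_seq_lift_max natr1.
by rewrite num_retainedS // rk Ly ceil_threshold // lez_nat.
Qed.

Lemma sum_ranks_lift n (t : 'S_n) (r : 'I_n.+1) : (0 < n)%N ->
  let x := perm_seq t in let y := perm_seq (lift_perm ord_max r t) in
  sum_ranks p y n.+1 = (sum_ranks p x n + num_ranked_above p x n r +
    (r < threshold p x n) * r.+1)%N.
Proof.
move=> n0 x y; have /andP[p0 p1] := p01.
have yx := fun i j ni nj => perm_seq_lift_le t r (i := i) (j := j) ni nj.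
have Ly : num_retained p y n = num_retained p x n by exact: num_retained_ext.
have rk : rank y n.+1 n = r.+1.
  by apply/eqP; rewrite -(eqr_nat R) rank_perm_seq // perm_seq_lift_max natr1.
rewrite sum_ranksS // rk Ly ceil_threshold // lez_nat; congr addn.
rewrite (retained_ext p yx) /sum_ranks /num_ranked_above -big_split /= !big_seq.
apply: eq_bigr => i /retained_lt ni; apply/eqP; rewrite -(eqr_nat R) natrD.
rewrite !rank_perm_seq ?leqW // perm_seq_lift // -!addrA.
(* Rank above [r] means value at least [r], that is, a value shifted by the insertion. *)
have -> : (r < rank x n i)%N = (r%:R <= x i).
  rewrite /x -(ltr_nat R) rank_perm_seq // (perm_seq_lt _ ni) natr1.
  by rewrite ltr_nat ler_nat.
by rewrite [1 + _]addrC.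
Qed.

Lemma threshold_le_n (x : nat -> R) n : (threshold p x n <= n)%N.
Proof. exact: leq_trans (threshold_le _ _ p01) (num_retained_le _ _ _). Qed.

Lemma perm_mean_num_retainedS n : (0 < n)%N ->
  perm_mean n.+1 (fun x => (num_retained p x n.+1)%:R) =
  perm_mean n (fun x => (num_retained p x n)%:R + (threshold p x n)%:R / n.+1%:R).
Proof.
move=> n0.
rewrite (@perm_mean_lift _ _ (fun x r =>
  (num_retained p x n)%:R + (r < threshold p x n)%N%:R * 1)).
  apply: eq_perm_mean => s; rewrite big_split /= (sum_ord_lt (fun=> 1)); last first.
    by rewrite leqW ?threshold_le_n.
  by rewrite !sumr_const !card_ord mulrDl -[X in X / _ + _]mulr_natr mulfK.
by move=> t r; rewrite num_retained_lift // natrD mulr1.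
Qed.

(** One computation serves both [A], with weight [1 / l], and [Q / L ^ 2], with weight [l ^ -2]. *)
Lemma perm_mean_sum_ranksS (g : nat -> R) n : (0 < n)%N ->
  perm_mean n.+1 (fun x => (sum_ranks p x n.+1)%:R * g (num_retained p x n.+1)) =
  perm_mean n (fun x =>
    let Q : R := (sum_ranks p x n)%:R in
    let L := num_retained p x n in
    let k := threshold p x n in
    Q * g L * (1 + 1 / n.+1%:R) +
    (k%:R * (k%:R + 1) / 2 * g L.+1 -
     (g L - g L.+1) * (k%:R * Q + \sum_(r < k) (num_ranked_above p x n r)%:R))
    / n.+1%:R).
Proof.
move=> n0.
(* [f] is the correction when the newcomer is retained: its own rank enters, and the weight of the
   old ranks changes from [g L] to [g L.+1]. *)
pose f x r : R := r.+1%:R * g (num_retained p x n).+1 -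
   (g (num_retained p x n) - g (num_retained p x n).+1) *
   (sum_ranks p x n + num_ranked_above p x n r)%:R.
rewrite (@perm_mean_lift _ _ (fun x r =>
  (sum_ranks p x n + num_ranked_above p x n r)%:R * g (num_retained p x n) +
  (r < threshold p x n)%N%:R * f x r)).
  apply: eq_perm_mean => s /=; rewrite big_split /=.
  rewrite (sum_ord_lt (f _)) ?leqW ?threshold_le_n // /f sumrB.
  rewrite -mulr_suml -mulr_sumr.
  rewrite -mulr_suml sum_succ -!natr_sum !big_split /= sum_num_ranked_above.
  rewrite !sum_nat_const !card_ord !natrD !natrM natr_sum.
  by field; rewrite gt_eqF // ltr_pwDl.
move=> t r; rewrite num_retained_lift // sum_ranks_lift // /f.
case: (r < _)%N; rewrite ?addn0 ?addn1 ?mul0n ?mul1n ?mul0r ?mul1r ?addr0 ?addn0 //.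
rewrite !natrD; ring.
Qed.

(** [x 0 + 1] is the rank of the first item, and exactly that many insertion positions push this
    item up by one; so each insertion multiplies the mean by a fixed factor. *)
Lemma perm_mean_rank0 n : (0 < n)%N ->
  perm_mean n (fun x => x 0%N + 1) = n.+1%:R / 2.
Proof.
case: n => // n _; elim: n => [|n IH].
  transitivity (perm_mean 1 (fun=> 1)); last by rewrite perm_mean_cst divff.
  apply: eq_perm_mean => s; rewrite (perm_seq_lt s (ltnSn 0)) [s _]ord1.
  by rewrite add0r.
rewrite (@perm_mean_lift _ _ (fun x r =>
  (x 0%N + 1) + (r%:R <= x 0%N)%R%:R)); last first.
  by move=> t r; rewrite perm_seq_lift // addrAC.
transitivity (perm_mean n.+1 (fun x => (1 + 1 / n.+2%:R) * (x 0%N + 1))); last first.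
  by rewrite perm_meanZ IH; field; rewrite -natr1 gt_eqF // ltr_wpDl.
apply: eq_perm_mean => s; rewrite big_split /= sumr_const card_ord.
rewrite (perm_seq_lt s (ltn0Sn n)); move: (s _) => k.
have -> : \sum_(r < n.+2) (r%:R <= k%:R :> R)%R%:R = k.+1%:R :> R.
  have := @sum_ord_lt n.+2 k.+1 (fun=> 1) (leqW (ltn_ord k)).
  rewrite sumr_const card_ord => <-; apply: eq_bigr => r _.
  by rewrite ler_nat ltnS mulr1.
rewrite -[(_ + 1) *+ _]mulr_natr mulrDl mulfK ?pnatr_eq0 // natr1.
by rewrite mulrDl mul1r mul1r mulrC.
Qed.

(** * Recursions for the means *)

Let meanL n : R := perm_mean n (fun x => (num_retained p x n)%:R).
Let meanA n : R := perm_mean n (fun x => avg_rank p x n).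
(* Bounds the error of replacing [threshold / (L + 1)] by [p] in the recursion
   for [meanA]. *)
Let meanU n : R := perm_mean n (fun x =>
  (sum_ranks p x n)%:R * (num_retained p x n)%:R ^- 2).

Lemma mean_num_retained_step n : (0 < n)%N ->
  meanL n * (1 + p / n.+1%:R) <= meanL n.+1 <=
  meanL n * (1 + p / n.+1%:R) + 1 / n.+1%:R.
Proof.
move=> n0; have /andP[p0 p1] := p01.
have -> : meanL n.+1 = _ := perm_mean_num_retainedS n0.
have i0 : 0 <= n.+1%:R^-1 :> R by rewrite invr_ge0.
have E : meanL n * (1 + p / n.+1%:R) =
    perm_mean n (fun x => (1 + p / n.+1%:R) * (num_retained p x n)%:R).
  by rewrite perm_meanZ mulrC.
rewrite E -[1 / n.+1%:R](perm_mean_cst n) -perm_meanD.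
apply/andP; split; apply: le_perm_mean => s.
  rewrite mulrDl mul1r lerD2l mulrAC ler_wpM2r //; exact: threshold_ge.
rewrite mulrDl mul1r -addrA lerD2l mulrAC -mulrDl ler_wpM2r // ltW //.
exact: threshold_lt.
Qed.

Lemma mean_num_retained_bounds n : (0 < n)%N -> 1 <= meanL n <= n%:R.
Proof.
move=> n0; rewrite /meanL; apply/andP; split.
  rewrite -[leLHS](perm_mean_cst n); apply: le_perm_mean => s.
  by rewrite ler1n num_retained_gt0.
rewrite -[leRHS](perm_mean_cst n); apply: le_perm_mean => s.
by rewrite ler_nat num_retained_le.
Qed.

(* With [k ~ p L] the right-hand side is about [2 p L ^- 2]; the constants are
   the worst cases [L = 2] (with [k = 1]) and [L = 3], and exceed [min p (1 / 2)],
   which is all that the comparison of exponents needs. *)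
Lemma sqr_decrement_ge (L k : nat) (d : R) :
  (0 < L)%N -> (0 < k)%N -> p * L%:R <= k%:R ->
  d <= 5 / 9 -> d <= 21 / 16 * p ->
  d * L%:R ^- 2 <= k%:R * (L%:R ^- 2 - L.+1%:R ^- 2).
Proof.
move=> L0 k0 pk d1 d2.
have L0' : 0 < L%:R :> R by rewrite ltr0n.
have k1 : 1 <= k%:R :> R by rewrite ler1n.
suff H : d * (L%:R + 1) ^+ 2 <= k%:R * (2 * L%:R + 1).
  rewrite -natr1.
  rewrite (_ : L%:R ^- 2 - _ =
    (2 * L%:R + 1) * (L%:R + 1) ^- 2 * L%:R ^- 2); last first.
    by field; rewrite !gt_eqF // ltr_pwDl.
  rewrite !mulrA ler_pM2r ?invr_gt0 ?exprn_gt0 // ler_pdivlMr // exprn_gt0 //.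
have [L3|L3] := leqP 3 L.
  have L3' : 3 <= L%:R :> R by rewrite (ler_nat _ 3).
  have /andP[p0 _] := p01.
  nra.
have [L1|L2] : L = 1%N \/ L = 2%N by lia.
  rewrite L1; nra.
rewrite L2; nra.
Qed.

(** The weight [l ^ -2] decreases, so the pushed-up ranks enter with a negative sign and are
    dropped. [sqr_decrement_ge] yields the loss [d], and a retained newcomer adds at most [1 / 2]
    because [k <= L]. *)
Lemma mean_weighted_ranks_step (d : R) n : (0 < n)%N ->
  d <= 5 / 9 -> d <= 21 / 16 * p ->
  meanU n.+1 <= meanU n * (1 + (1 - d) / n.+1%:R) + (1 / 2) / n.+1%:R.
Proof.
move=> n0 d1 d2; have /andP[p0 p1] := p01.
have -> : meanU n.+1 = _ := perm_mean_sum_ranksS (fun l => l%:R ^- 2) n0.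
have -> : meanU n * (1 + (1 - d) / n.+1%:R) + (1 / 2) / n.+1%:R =
    perm_mean n (fun x => (1 + (1 - d) / n.+1%:R) *
      ((sum_ranks p x n)%:R * (num_retained p x n)%:R ^- 2) + (1 / 2) / n.+1%:R).
  by rewrite perm_meanD perm_meanZ perm_mean_cst mulrC.
apply: le_perm_mean => s /=; set x := perm_seq s.
have L0 := num_retained_gt0 p x n0.
have k0 := threshold_gt0 x p0 n0.
have pk := threshold_ge x n p0.
have kL := threshold_le x n p01.
have i0 : 0 <= n.+1%:R^-1 :> R by rewrite invr_ge0.
move: (num_retained p x n) (threshold p x n) (sum_ranks p x n) L0 k0 pk kL.
move=> L k q L0 k0 pk kL.
have N0 : 0 <= \sum_(r < k) (num_ranked_above p x n r)%:R :> R by apply: sumr_ge0.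
move: (\sum_(r < k) _) N0 => N N0.
have dec := sqr_decrement_ge L0 k0 pk d1 d2.
have kL1 : k%:R <= L%:R :> R by rewrite ler_nat.
have L1 : 1 <= L%:R :> R by rewrite ler1n.
have gL : L.+1%:R ^- 2 <= L%:R ^- 2 :> R.
  by rewrite lef_pV2 ?posrE ?exprn_gt0 ?ltr0n // ler_sqr ?nnegrE // ler_nat.
have h1 : k%:R * (k%:R + 1) / 2 * L.+1%:R ^- 2 <= 1 / 2 :> R.
  rewrite ler_pdivrMr ?exprn_gt0 // -[L.+1%:R]natr1.
  have : k%:R * (k%:R + 1) <= L%:R * (L%:R + 1) :> R by rewrite ler_pM // lerD2r.
  nra.
move: (L%:R ^- 2) (L.+1%:R ^- 2) dec gL h1 => g g' dec gL h1.
set e := k%:R * _ / 2 * g' in h1 *.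
have q0 : 0 <= q%:R :> R by [].
have h2 := ler_wpM2r q0 dec.
have h3 : 0 <= (g - g') * N by rewrite mulr_ge0 // subr_ge0.
have -> : (1 + (1 - d) / n.+1%:R) * (q%:R * g) + 1 / 2 / n.+1%:R =
   q%:R * g * (1 + 1 / n.+1%:R) + (1 / 2 - d * g * q%:R) / n.+1%:R.
  by ring.
rewrite lerD2l ler_wpM2r //; lra.
Qed.

Lemma mean_avg_rank_step n : (0 < n)%N ->
  `|meanA n.+1 -
    (meanA n * (1 + (1 - p) / n.+1%:R) + p ^+ 2 / 2 * meanL n / n.+1%:R)|
    <= (3 / 2 + meanU n) / n.+1%:R.
Proof.
move=> n0; have /andP[p0 p1] := p01.
have -> : meanA n.+1 = _ := perm_mean_sum_ranksS (fun l => l%:R^-1) n0.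
have -> : (3 / 2 + meanU n) / n.+1%:R = perm_mean n (fun x =>
    n.+1%:R^-1 * (3 / 2 + (sum_ranks p x n)%:R * (num_retained p x n)%:R ^- 2)).
  by rewrite perm_meanZ perm_meanD perm_mean_cst mulrC.
have -> : meanA n * (1 + (1 - p) / n.+1%:R) + p ^+ 2 / 2 * meanL n / n.+1%:R =
   perm_mean n (fun x => (1 + (1 - p) / n.+1%:R) * avg_rank p x n +
      p ^+ 2 / 2 / n.+1%:R * (num_retained p x n)%:R).
  by rewrite perm_meanD !perm_meanZ mulrC [in RHS]mulrAC.
rewrite -[X in _ - X]mul1r -mulNr -perm_meanZ -perm_meanD.
apply: normr_perm_mean_le => s /=; rewrite /avg_rank; set x := perm_seq s.
have L0 := num_retained_gt0 p x n0.
have pk := threshold_ge x n p0.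
have pk1 := threshold_lt x n p0.
have kL := threshold_le x n p01.
have i0 : 0 <= n.+1%:R^-1 :> R by rewrite invr_ge0.
have Nk : \sum_(r < threshold p x n) (num_ranked_above p x n r)%:R <=
    (threshold p x n)%:R * (num_retained p x n)%:R :> R.
  rewrite -natr_sum -natrM ler_nat -[X in (_ <= X * _)%N]card_ord -sum_nat_const.
  by apply: leq_sum => r _; exact: num_ranked_above_le.
move: (num_retained p x n) (threshold p x n) (sum_ranks p x n) L0 pk pk1 kL Nk.
move=> L k q L0 pk pk1 kL Nk.
have N0 : 0 <= \sum_(r < k) (num_ranked_above p x n r)%:R :> R by apply: sumr_ge0.
move: (\sum_(r < k) _) N0 Nk => N N0 Nk.
have L0' : 0 < L%:R :> R by rewrite ltr0n.
have kL1 : k%:R <= L%:R :> R by rewrite ler_nat.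
have q0 : 0 <= q%:R :> R by [].
have k0 : 0 <= k%:R :> R by [].
rewrite -[L.+1%:R]natr1; move: (L%:R) (k%:R) (q%:R) L0' kL1 q0 k0 pk pk1 Nk.
move=> l c t l0 cl t0 c0 pc pc1 Nc.
have l10 : 0 < l + 1 by rewrite addr_gt0.
(* Three errors: [A] from replacing [c * (c + 1)] by [p ^ 2 * l * (l + 1)] in the newcomer's share,
   [B] from reweighting the pushed-up ranks, [C] from replacing [c / (l + 1)] by [p]. The first two
   lie in [[0, 3 / 2]] and [[0, 1]]; [C] is at most [t / l ^ 2] in absolute value, as [c] is within
   1 of [p * (l + 1)]. *)
pose A := (c * (c + 1) - p ^+ 2 * l * (l + 1)) / 2 / (l + 1).
pose B := N / (l * (l + 1)).
pose C := (p * (l + 1) - c) * t / (l * (l + 1)).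
rewrite [X in `|X|](_ : _ = n.+1%:R^-1 * (A - B + C)); last first.
  rewrite /A /B /C; move: (n.+1%:R^-1) => i; rewrite !mul1r; field.
  by rewrite !gt_eqF.
rewrite normrM ger0_norm // ler_wpM2l //.
apply: le_trans (ler_normD _ _) _; apply: lerD.
  have A0 : 0 <= A.
    rewrite /A -mulrA mulr_ge0 //; first nra.
    by rewrite mulr_ge0 ?invr_ge0 // ltW.
  have A1 : A <= 3 / 2.
    rewrite /A ler_pdivrMr // ler_pdivrMr //; nra.
  have B0 : 0 <= B by rewrite /B divr_ge0 // mulr_ge0 // ltW.
  have B1 : B <= 1 by rewrite /B ler_pdivrMr ?mulr_gt0 //; nra.
  rewrite ler_norml; lra.
rewrite /C -mulrA normrM [X in _ * X]ger0_norm; last first.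
  by rewrite divr_ge0 // mulr_ge0 // ltW.
rewrite -[leRHS]mul1r ler_pM ?divr_ge0 ?mulr_ge0 ?(ltW l0) ?(ltW l10) //.
  by rewrite ler_norml; lra.
rewrite ler_wpM2l // lef_pV2 ?posrE ?mulr_gt0 ?exprn_gt0 // expr2 ler_pM2l //.
by rewrite lerDl.
Qed.

(* AM-GM: [r / L + t ^ 2 L >= 2 t sqrt r >= 2 t r / sqrt n], where [r <= n] is
   the rank of the first item, which is always retained. *)
Lemma mean_avg_rank_ge n (t : R) : (0 < n)%N -> 0 <= t ->
  t * Num.sqrt n%:R - t ^+ 2 * meanL n <= meanA n.
Proof.
move=> n0 t0; have n0' : 0 < n%:R :> R by rewrite ltr0n.
pose w : R := Num.sqrt n%:R.
have w0 : 0 < w by rewrite sqrtr_gt0.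
have w2 : w ^+ 2 = n%:R by rewrite sqr_sqrtr // ltW.
rewrite -/w.
have step : perm_mean n (fun x => 2 * t / w * (x 0%N + 1) +
    (- t ^+ 2) * (num_retained p x n)%:R) <= meanA n.
  apply: le_perm_mean => s; rewrite /avg_rank; set x := perm_seq s.
  have r0 : (rank x n 0)%:R = x 0%N + 1 by exact: rank_perm_seq.
  rewrite -r0.
  have rn : (rank x n 0)%:R <= n%:R :> R by rewrite ler_nat rank_le.
  have rQ : (rank x n 0)%:R <= (sum_ranks p x n)%:R :> R.
    rewrite ler_nat /sum_ranks (big_rem 0%N) ?mem0_retained //=; exact: leq_addr.
  have L0 : 0 < (num_retained p x n)%:R :> R by rewrite ltr0n num_retained_gt0.
  apply: le_trans (_ : _ <= (rank x n 0)%:R / (num_retained p x n)%:R) _; last first.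
    by rewrite ler_pM2r // invr_gt0.
  move: ((num_retained p x n)%:R) ((rank x n 0)%:R) (ler0n R (rank x n 0)) rn L0.
  move=> l r r1 rn l0.
  rewrite -w2 in rn.
  have := mulr_ge0 (divr_ge0 r1 (ltW l0)) (sqr_ge0 (1 - t * l / w)).
  have -> : r / l * (1 - t * l / w) ^+ 2 =
      r / l - 2 * t / w * r + t ^+ 2 * l * (r / w ^+ 2).
    by field; rewrite !gt_eqF.
  have : r / w ^+ 2 <= 1 by rewrite ler_pdivrMr ?exprn_gt0 // mul1r.
  have tl : 0 <= t ^+ 2 * l by rewrite mulr_ge0 ?sqr_ge0 // ltW.
  move/(ler_wpM2l tl); lra.
rewrite perm_meanD !perm_meanZ perm_mean_rank0 // in step.
apply: le_trans step; rewrite mulNr lerD2r.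
rewrite -[n.+1%:R]natr1 -w2 [leRHS](_ : _ = t * w + t / w); last by field; rewrite gt_eqF.
by rewrite lerDl divr_ge0 // ltW.
Qed.

End permutation_model.

(** * Uniformity of the order of i.i.d. continuous variables *)

Section finite_weights.
Context {R : realType}.

(** The product of [1 - i / M] over [i < n] is at least [1 - n ^ 2 / M], written without division:
    collisions of [n] items among [M] cells become negligible. *)
Lemma ffact_lower (M n : nat) : (n <= M)%N ->
  M%:R ^+ n * (M%:R - n%:R ^+ 2) <= M%:R * (M ^_ n)%:R :> R.
Proof.
elim: n => [|n IH] nM; first by rewrite expr0 mul1r expr0n subr0 ffactn0 mulr1.
have {}IH := IH (ltnW nM).
rewrite ffactnSr natrM natrB ?(ltnW nM) // mulrA.
have nM' : n%:R <= M%:R :> R by rewrite ler_nat ltnW.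
have : 0 <= M%:R - n%:R :> R by rewrite subr_ge0.
move=> /(ler_wpM2r); move=> /(_ _ _ IH); apply: le_trans.
rewrite exprS -natr1 -!mulrA mulrCA ler_wpM2l ?exprn_ge0 //.
have : 0 <= n%:R :> R by [].
move: (n%:R) (M%:R) nM' => a b ab a0.
nra.
Qed.

(** The weight [r], uniform on the image of [g], lies below [q] and has the same total 1, so the two
    coincide. *)
Lemma uniform_weights (C S : finType) (q : C -> R) (g : S -> C) (f : C -> R) :
  (forall c, 0 <= q c) -> \sum_c q c = 1 -> injective g ->
  (0 < #|S|)%N -> (forall s, #|S|%:R^-1 <= q (g s)) ->
  \sum_c f c * q c = #|S|%:R^-1 * \sum_s f (g s).
Proof.
move=> q0 q1 ginj S0 qg.
pose r c : R := \sum_s (g s == c)%:R * #|S|%:R^-1.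
have rE h : \sum_c h c * r c = #|S|%:R^-1 * \sum_s h (g s).
  under eq_bigr do rewrite mulr_sumr.
  rewrite exchange_big mulr_sumr /=; apply: eq_bigr => s _.
  rewrite (bigD1 (g s)) //= eqxx mul1r big1 ?addr0 1?mulrC // => c /negbTE.
  by rewrite eq_sym => ->; rewrite mul0r mulr0.
have rq c : r c <= q c.
  rewrite /r; have [/existsP[s /eqP <-]|] := boolP [exists s, g s == c].
    rewrite (bigD1 s) //= eqxx mul1r big1 ?addr0 // => s' s's.
    by rewrite (inj_eq ginj) (negbTE s's) mul0r.
  rewrite negb_exists => /forallP gc; rewrite big1 // => s _.
  by rewrite (negbTE (gc s)) mul0r.
have r1 : \sum_c r c = 1.
  have := rE (fun=> 1); under eq_bigr do rewrite mul1r.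
  by rewrite sumr_const => ->; rewrite mulVf // pnatr_eq0 -lt0n.
have qr c : q c = r c.
  have : \sum_c (q c - r c) = 0 by rewrite sumrB q1 r1 subrr.
  move/eqP; rewrite psumr_eq0 => [/allP/(_ c)|i _]; last by rewrite subr_ge0.
  by rewrite mem_index_enum => /(_ isT) /=; rewrite subr_eq0 => /eqP.
by rewrite -rE; apply: eq_bigr => c _; rewrite qr.
Qed.

End finite_weights.

Section order_pattern.
Context {R : realType}.

(** A comparison table takes finitely many values and, unlike a permutation, can record ties. *)
Definition order_pattern n (x : nat -> R) : {ffun 'I_n * 'I_n -> bool} :=
  [ffun ij : 'I_n * 'I_n => x ij.1 <= x ij.2].

Definition perm_pattern n (s : 'S_n) : {ffun 'I_n * 'I_n -> bool} :=
  order_pattern n (perm_seq s).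

Lemma order_patternP n (x y : nat -> R) : order_pattern n x = order_pattern n y ->
  forall i j, (i < n)%N -> (j < n)%N -> (x i <= x j) = (y i <= y j).
Proof.
move=> e i j ni nj.
have := congr1 (fun f : {ffun _} => f (Ordinal ni, Ordinal nj)) e.
by rewrite !ffunE.
Qed.

(** Ranks can be read off the pattern, and for a permutation they are its values plus 1. *)
Lemma perm_pattern_inj n : injective (@perm_pattern n).
Proof.
move=> s t e; apply/permP => i; apply: val_inj => /=.
apply/eqP; rewrite -(eqr_nat R) -!perm_seqE -(inj_eq (addIr 1)).
rewrite -!rank_perm_seq //; apply/eqP; congr _%:R; apply: rank_ext => j nj.
exact: order_patternP e _ _ nj (ltn_ord i).
Qed.

(* Strictly increasing maps composed with [s] have the order pattern of [s]. *)
Lemma card_pattern_ge n M (s : 'S_n) :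
  ('C(M, n) <= #|[set y : {ffun 'I_n -> 'I_M} |
     [forall i, forall j, (y i <= y j)%N == (s i <= s j)%N]]%SET|)%N.
Proof.
rewrite -card_ltn_sorted_tuples.
pose g (t : n.-tuple 'I_M) : {ffun 'I_n -> 'I_M} := [ffun i => tnth t (s i)].
have ginj : injective g.
  move=> t t' e; apply: eq_from_tnth => i.
  have := congr1 (fun f : {ffun _} => f ((s^-1)%g i)) e.
  by rewrite !ffunE permKV.
rewrite -(card_imset _ ginj); apply: subset_leq_card.
apply/fintype.subsetP => _ /imsetP[t + ->]; rewrite !inE => st.
apply/forallP => i; apply/forallP => j; rewrite !ffunE.
have mono (a b : 'I_n) : (a < b)%N -> (tnth t a < tnth t b)%N.
  move=> ab; have /(sorted_ltn_nth ltn_trans) := st.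
  move=> /(_ 0%N a b); rewrite !inE size_map size_tuple !ltn_ord.
  by rewrite !(nth_map (tnth t a)) ?size_tuple ?ltn_ord // -!tnth_nth; apply.
apply/eqP; case: (ltngtP (s i) (s j)) => [/mono /ltnW -> //|/mono|/val_inj ->].
  by rewrite ltnNge => /negbTE.
by rewrite leqnn.
Qed.

End order_pattern.

Section disjoint_events.
Context d (T : measurableType d) (R : realType) (P : probability T R).
Local Open Scope ereal_scope.

(** Induction removes one [G i] from [E] at a time. *)
Lemma sum_disjoint_le (I : eqType) (r : seq I) (G : I -> set T) (E : set T) :
  uniq r -> (forall i, measurable (G i)) -> measurable E ->
  (forall i j w, G i w -> G j w -> i = j) ->
  (forall i, i \in r -> G i `<=` E) ->
  \sum_(i <- r) P (G i) <= P E.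
Proof.
elim: r E => [|i r IH] E /=; first by rewrite big_nil.
move=> /andP[ir ur] mG mE dG GE; rewrite big_cons.
rewrite (measureDI P mE (mG i)) addeC; apply: leeD; last first.
  by rewrite setIidr //; apply: GE; rewrite inE eqxx.
apply: IH => //; first exact: measurableD.
move=> j jr w Gjw; split; first by apply: (GE j) => //; rewrite inE jr orbT.
by move=> Giw; move: ir; rewrite (dG _ _ _ Giw Gjw) jr.
Qed.

End disjoint_events.

(** * From cells of equal probability to the law of the order *)

Section exchangeability.
Context d (T : measurableType d) (R : realType) (P : probability T R).
Variable X : nat -> {RV P >-> R}.
Hypothesis iidX : iid_continuous X.

(** Continuity of the distribution function enters through the intermediate value theorem; equality
    in law gives one [t] for all items. *)
Lemma quantile (v : R) : 0 < v < 1 ->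
  exists t : R, forall i, P (X i @^-1` `]-oo, t]) = v%:E.
Proof.
move=> /andP[v0 v1]; have [_ idX contX] := iidX.
have fin r : cdf (X 0%N) r \is a fin_num by rewrite fin_num_measure.
pose f r := fine (cdf (X 0%N) r).
have fE r : cdf (X 0%N) r = (f r)%:E by rewrite fineK.
have fcont : continuous f.
  by move=> r; apply: fine_cvg; rewrite -/(f r) -fE; exact: contX.
have [a fa] : exists a, f a < v.
  have h : f @ -oo --> (0 : R) by apply: fine_cvg; exact: cvg_cdfNy0.
  by apply: (filter_ex (F := -oo)); exact: (cvgr_lt _ h).
have [b fb] : exists b, v < f b.
  have h : f @ +oo --> (1 : R) by apply: fine_cvg; exact: cvg_cdfy1.
  by apply: (filter_ex (F := +oo)); exact: (cvgr_gt _ h).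
have ab : a <= b.
  rewrite leNgt; apply/negP => /ltW /(cdf_nondecreasing (X 0%N)).
  by rewrite !fE lee_fin => /(lt_le_trans fb) /lt_trans /(_ fa); rewrite ltxx.
have [||t _ ft] := @IVT R f a b v ab.
- exact: continuous_subspaceT.
- by rewrite ge_min le_max (ltW fa) (ltW fb) orbT.
exists t => i; have := idX i 0%N `]-oo, t]%classic (measurable_itv _).
by rewrite /distribution /pushforward /= => ->; rewrite -ft -fE.
Qed.

(** [quantile] covers only levels strictly between 0 and 1; cuts are therefore sets, with [set0] and
    [setT] at the two ends. *)
Lemma quantile_cuts (M : nat) : (0 < M)%N ->
  exists B : nat -> set R,
  [/\ forall j, measurable (B j),
      forall j x y, x <= y -> B j y -> B j x
    & forall i j, (j <= M)%N -> P (X i @^-1` B j) = (j%:R / M%:R)%:E].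
Proof.
move=> M0; have M0' : 0 < M%:R :> R by rewrite ltr0n.
have : forall j, exists t : R, (0 < j < M)%N ->
    forall i, P (X i @^-1` `]-oo, t]) = (j%:R / M%:R)%:E.
  move=> j; have [/andP[j0 jM]|_] := boolP (0 < j < M)%N; last by exists 0.
  have [|t Ht] := @quantile (j%:R / M%:R); last by exists t.
  by rewrite divr_gt0 ?ltr0n // ltr_pdivrMr // mul1r ltr_nat.
move=> /boolp.choice[t Ht].
exists (fun j => if j == 0%N then set0 else
  if (j < M)%N then `]-oo, t j]%classic else setT).
split=> [j|j x y xy|i j jM].
- by case: ifP => // _; case: ifP.
- case: ifP => // _; case: ifP => // _ /=; rewrite !in_itv /=.
  exact: le_trans.
case: eqP => [->|/eqP j0]; first by rewrite preimage_set0 measure0 mul0r.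
case: ltnP => [jM'|Mj]; first by rewrite Ht // lt0n j0.
have -> : j = M by apply/eqP; rewrite eqn_leq jM.
by rewrite preimage_setT probability_setT divff // gt_eqF.
Qed.

Lemma quantile_cells (M : nat) : (0 < M)%N ->
  exists D : 'I_M -> set R,
  [/\ forall k, measurable (D k),
      forall (k l : 'I_M) x y, (k < l)%N -> D k x -> D l y -> x < y
    & forall i k, P (X i @^-1` D k) = (M%:R^-1)%:E].
Proof.
move=> M0; have [B [mB downB PB]] := quantile_cuts M0.
have M0' : 0 < M%:R :> R by rewrite ltr0n.
have mXB i j : measurable (X i @^-1` B j).
  by rewrite -[X in measurable X]setTI; exact: measurable_funPT.
(* Down-closed sets of reals are comparable, and the strict order of their probabilities decides the
   direction. *)
have nested k l : (k < l <= M)%N -> B k `<=` B l.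
  move=> /andP[kl lM] x Bkx; apply: contrapT => nBlx.
  have BlBk : B l `<=` B k.
    move=> y Bly; apply: (downB _ _ _ _ Bkx); rewrite leNgt; apply/negP => /ltW xy.
    exact: nBlx (downB _ _ _ xy Bly).
  have : (P (X 0%N @^-1` B l) <= P (X 0%N @^-1` B k))%E.
    by apply: le_measure; rewrite ?inE //; exact: preimage_subset.
  rewrite !PB // ?(leq_trans (ltnW kl)) // lee_fin ler_pM2r ?invr_gt0 //.
  by rewrite ler_nat leqNgt kl.
exists (fun k => B k.+1 `\` B k); split => [k|k l x y kl [Bx _] [_ By]|i k].
- exact: measurableD.
- rewrite ltNge; apply/negP => yx; apply: By; apply: (downB _ _ _ yx).
  move: kl; rewrite leq_eqVlt => /orP[/eqP <- //|kl].
  by apply: nested Bx; rewrite kl ltnW.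
rewrite (_ : _ @^-1` _ = X i @^-1` B k.+1 `\` X i @^-1` B k) //.
rewrite measureD //; last first.
  by rewrite (le_lt_trans (probability_le1 _ _)) ?ltry.
rewrite setIidr; last first.
  by apply: preimage_subset; apply: nested; rewrite ltnSn ltn_ord.
transitivity ((k.+1%:R / M%:R : R)%:E - (k%:R / M%:R : R)%:E)%E.
  by congr (_ - _)%E; apply: PB => //; exact: ltnW.
by rewrite -EFinB -mulrBl -natr1 addrAC subrr add0r mul1r.
Qed.

Lemma prob_cells n M (D : 'I_M -> set R) (y : {ffun 'I_n -> 'I_M}) :
  (0 < M)%N ->
  (forall k, measurable (D k)) ->
  (forall i k, P (X i @^-1` D k) = (M%:R^-1)%:E) ->
  P (\bigcap_(i : 'I_n) (X i @^-1` D (y i))) = (M%:R ^- n)%:E.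
Proof.
move=> M0 mD PD; have [indX _ _] := iidX.
(* Independence is stated for families over [nat], so the events are extended by [setT]. *)
pose A j := if insub j is Some i then D (y i) else setT.
pose J := [fset j in iota 0 n]%fset.
have mA j : measurable (A j) by rewrite /A; case: insub.
have <- : \bigcap_(j in [set` J]) (X j @^-1` A j) =
  \bigcap_(i : 'I_n) (X i @^-1` D (y i)).
  apply/seteqP; split=> w /= h.
    move=> i _; have := h i; rewrite /A /= valK; apply.
    by rewrite /= !inE mem_iota add0n ltn_ord.
  move=> j /=; rewrite /J !inE mem_iota add0n => nj.
  by rewrite /A insubT; exact: (h (Ordinal nj)).
rewrite (indX J A mA) big_seq.
under eq_bigr => j.
  rewrite !inE mem_iota add0n => nj.
  rewrite (_ : P _ = (M%:R^-1)%:E); last by rewrite /A insubT /=; exact: PD.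
  over.
rewrite -big_seq prodEFin big_const_seq count_predT iter_mulr_1.
by rewrite card_fseq undup_id ?iota_uniq // size_iota exprVn.
Qed.

Lemma measurable_order_pattern n (c : {ffun 'I_n * 'I_n -> bool}) :
  measurable [set w | order_pattern n (fun i => X i w) = c].
Proof.
rewrite (_ : [set _ | _] =
  \bigcap_(ij : 'I_n * 'I_n) [set w | (X ij.1 w <= X ij.2 w) = c ij]); last first.
  apply/seteqP; split=> w /= h; first by move=> ij _ /=; rewrite -h ffunE.
  by apply/ffunP => ij; rewrite ffunE; exact: (h ij).
apply: fin_bigcap_measurable => [|ij _]; first exact: finite_finset.
have mle : measurable_fun setT (fun w => X ij.1 w <= X ij.2 w).
  exact: measurable_fun_ler.
rewrite -[X in measurable X]setTI.
by have := mle measurableT [set c ij]; apply.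
Qed.

(* Cells of probability [1 / M]: when the items fall in distinct cells, the order
   of the cells is the order of the items. *)
Lemma prob_perm_pattern_ge_bin n M (s : 'S_n) : (0 < M)%N ->
  (('C(M, n)%:R / M%:R ^+ n)%:E <=
   P [set w | order_pattern n (fun i => X i w) = @perm_pattern R n s])%E.
Proof.
move=> M0; have [D [mD Dlt PD]] := quantile_cells M0.
pose Y := [set y : {ffun 'I_n -> 'I_M} |
  [forall i, forall j, (y i <= y j)%N == (s i <= s j)%N]]%SET.
pose G (y : {ffun 'I_n -> 'I_M}) := \bigcap_(i : 'I_n) (X i @^-1` D (y i)).
have mG y : measurable (G y).
  apply: fin_bigcap_measurable => [|i _]; first exact: finite_finset.
  by rewrite -[X in measurable X]setTI; exact: measurable_funPT.
have Dinj k l x : D k x -> D l x -> k = l.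
  move=> Dk Dl; apply: ord_inj; apply/eqP; rewrite eqn_leq.
  apply/andP; split; rewrite leqNgt; apply/negP => kl.
    by have := Dlt _ _ _ _ kl Dl Dk; rewrite ltxx.
  by have := Dlt _ _ _ _ kl Dk Dl; rewrite ltxx.
have GE y : y \in enum Y ->
    G y `<=` [set w | order_pattern n (fun i => X i w) = @perm_pattern R n s].
  rewrite mem_enum inE => /forallP ys w Gw /=; apply/ffunP => -[i j].
  rewrite !ffunE /= !perm_seqE ler_nat.
  have {}ys a b : (y a <= y b)%N = (s a <= s b)%N.
    by have /forallP/(_ b)/eqP := ys a.
  have mono a b : (s a < s b)%N -> X a w < X b w.
    move=> ab; apply: (Dlt (y a) (y b)); [|exact: Gw|exact: Gw].
    by rewrite ltnNge ys -ltnNge.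
  case: (ltngtP (s i) (s j)) => [/mono /ltW -> //|/mono|/val_inj/perm_inj ->].
    by rewrite ltNge => /negbTE.
  by rewrite lexx.
have := @sum_disjoint_le _ _ _ P _ (enum Y) G _ (enum_uniq _) mG
  (measurable_order_pattern _) _ GE.
have Gdisj y y' w : G y w -> G y' w -> y = y'.
  by move=> Gy Gy'; apply/ffunP => i; exact: Dinj (Gy i I) (Gy' i I).
move=> /(_ Gdisj); apply: le_trans.
under eq_bigr do rewrite (prob_cells _ M0 mD PD).
rewrite sumEFin lee_fin big_const_seq count_predT iter_addr_0 -cardE -[leRHS]mulr_natl.
by rewrite ler_wpM2r ?invr_ge0 ?exprn_ge0 // ler_nat card_pattern_ge.
Qed.

(* These lower bounds already add up to 1, so they are equalities and ties have
   probability 0; see [uniform_weights]. *)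
Lemma prob_perm_pattern_ge n (s : 'S_n) :
  ((n`!%:R^-1)%:E <=
   P [set w | order_pattern n (fun i => X i w) = @perm_pattern R n s])%E.
Proof.
have fin : P [set w | order_pattern n (fun i => X i w) = @perm_pattern R n s] \is a fin_num.
  by rewrite fin_num_measure //; exact: measurable_order_pattern.
rewrite -(fineK fin) lee_fin; set e := fine _; apply/ler_addgt0Pr => eps eps0.
have f0 : 0 < n`!%:R :> R by rewrite ltr0n fact_gt0.
(* By [ffact_lower] the bound from [M] cells falls short of [1 / n!] by at most [K / M]; [M] is
   chosen to make this at most [eps]. *)
pose K : R := n%:R ^+ 2 / n`!%:R.
pose M := maxn n (Num.truncn (K / eps)).+1.
have M0 : (0 < M)%N by rewrite leq_max orbT.
have M0' : 0 < M%:R :> R by rewrite ltr0n.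
have := prob_perm_pattern_ge_bin s M0; rewrite -(fineK fin) lee_fin -/e => he.
have nM : (n <= M)%N by rewrite leq_maxl.
have KM : K / M%:R <= eps.
  rewrite ler_pdivrMr // mulrC -ler_pdivrMr //; apply: ltW.
  by apply: lt_le_trans (truncnS_gt _) _; rewrite ler_nat leq_maxr.
suff : n`!%:R^-1 - K / M%:R <= 'C(M, n)%:R / M%:R ^+ n by lra.
have := @ffact_lower R _ _ nM; rewrite -bin_ffact natrM => h.
rewrite ler_pdivlMr ?exprn_gt0 // /K.
rewrite -(ler_pM2l M0') -(ler_pM2r f0) -[leRHS]mulrA; apply: le_trans h.
rewrite le_eqVlt; apply/orP; left; apply/eqP; field.
by rewrite !gt_eqF.
Qed.

Lemma expectation_pattern_fun n (g : {ffun 'I_n * 'I_n -> bool} -> R) :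
  (forall c, 0 <= g c) ->
  'E_P[fun w => g (order_pattern n (fun i => X i w))]%E =
  (\sum_c g c * fine (P [set w | order_pattern n (fun i => X i w) = c]))%:E.
Proof.
move=> g0; rewrite unlock.
pose E c := [set w | order_pattern n (fun i => X i w) = c].
have mE c : measurable (E c) by exact: measurable_order_pattern.
have gE w : g (order_pattern n (fun i => X i w)) = \sum_c g c * \1_(E c) w.
  rewrite (bigD1 (order_pattern n (fun i => X i w))) //= indicE mem_set //= mulr1.
  rewrite big1 ?addr0 // => c /eqP nc; rewrite indicE memNset ?mulr0 //.
  by move=> /esym.
under eq_integral do rewrite gE -sumEFin.
rewrite ge0_integral_sum //; last 2 first.
- move=> c; apply/measurable_EFinP; apply: measurable_funM => //.
- by move=> c w _; rewrite lee_fin mulr_ge0.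
rewrite -sumEFin; apply: eq_bigr => c _.
rewrite (integralZl_indic measurableT (fun=> E c)) //; last first.
  by rewrite ltNge g0.
rewrite integral_indic // setIT EFinM fineK // fin_num_measure //; exact: mE.
Qed.

(** The order of the items has the law of a uniform permutation: [prob_perm_pattern_ge] feeds
    [uniform_weights]. *)
Lemma expectation_order_pattern n (F : (nat -> R) -> R) :
  (forall x, 0 <= F x) ->
  (forall x y, order_pattern n x = order_pattern n y -> F x = F y) ->
  'E_P[fun w => F (fun i => X i w)]%E = (perm_mean n F)%:E.
Proof.
move=> F0 Fpat.
(* The ranks, which determine the order, are read off the comparison table. *)
pose f (c : {ffun 'I_n * 'I_n -> bool}) : R :=
  F (fun i => if insub i is Some i' then (\sum_(j < n) c (j, i'))%N%:R else 0).
have fE x : F x = f (order_pattern n x).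
  apply: Fpat; apply/ffunP => -[i j]; rewrite !ffunE /= !valK ler_nat.
  under eq_bigr do rewrite ffunE /=.
  under [X in (_ <= X)%N]eq_bigr do rewrite ffunE /=.
  by rewrite [RHS](@rank_leE _ x n i j).
pose q c := fine (P [set w | order_pattern n (fun i => X i w) = c]).
(* The total mass is the expectation of the constant 1, seen as a function of the pattern. *)
have q1 : \sum_c q c = 1.
  apply: EFin_inj; rewrite -(expectation_cst P 1).
  rewrite -[cst 1]/(fun w => (fun=> 1) (order_pattern n (fun i => X i w))).
  rewrite expectation_pattern_fun //.
  by under [in RHS]eq_bigr do rewrite mul1r.
under eq_fun do rewrite fE.
rewrite (expectation_pattern_fun (g := f)) => [|c]; last exact: F0.
have cardS : #|{perm 'I_n}| = n`! by rewrite card_Sn.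
have := @uniform_weights _ _ _ q (@perm_pattern R n) f.
rewrite cardS => ->.
- by rewrite /perm_mean; congr (_ * _)%:E; apply: eq_bigr => s _; rewrite fE.
- by move=> c; exact: fine_ge0.
- exact: q1.
- exact: perm_pattern_inj.
- exact: fact_gt0.
move=> s; rewrite -lee_fin fineK; first exact: prob_perm_pattern_ge.
by rewrite fin_num_measure //; exact: measurable_order_pattern.
Qed.
End exchangeability.

(** [b] comes from averages over permutations, before any probability space is introduced, so one
    value serves all spaces. *)
Theorem theorem5p1 (R : realType) (p : R) (hp : 0 < p <= 1) :
  exists b : R, 0 < b /\
    forall (d : measure_display) (T : measurableType d) (P : probability T R)
      (X : nat -> {RV P >-> R}), iid_continuous X ->
      [/\ (E_avg_rank p X n / (a_norm p n)%:E)%E @[n --> \oo] --> b%:E,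
          p = 1 / 2 -> b%:E = (c_const p X / 8%:E)%E
        & 1 / 2 < p -> b%:E = ((p ^+ 2 / (2 * (2 * p - 1)))%:E * c_const p X)%E].
Proof.
pose l n := perm_mean n (fun x : nat -> R => (num_retained p x n)%:R).
pose a n := perm_mean n (fun x : nat -> R => avg_rank p x n).
have [c [b [b0 hc hb b_half b_gt]]] := avg_num_asymptotics hp
  (@mean_num_retained_step _ _ hp) (@mean_num_retained_bounds _ p)
  (@mean_weighted_ranks_step _ _ hp) (@mean_avg_rank_step _ _ hp)
  (@mean_avg_rank_ge _ p).
exists b; split=> // d T P X iidX.
have cvg_fin (u : nat -> R) v :
    u n @[n --> \oo] --> v -> (u n)%:E @[n --> \oo] --> v%:E.
  by move=> uv; apply: cvg_EFin uv; exact: nearW.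
(* At [n = 1] and [p = 1 / 2] the norm vanishes because [ln 1 = 0]; only large [n] matter for the
   limit. *)
have a_normE (r : R) n : (1 < n)%N -> (r%:E / (a_norm p n)%:E)%E = (r / a_norm p n)%:E.
  move=> n1; rewrite inver gt_eqF // /a_norm.
  have n0 : 0 < n%:R :> R by rewrite ltr0n ltnW.
  case: ifP => _; last case: ifP => _; rewrite ?mulr_gt0 ?powR_gt0 //.
  by rewrite ln_gt0 // ltr1n.
have EL n : E_num_retained p X n = (l n)%:E.
  rewrite /E_num_retained (expectation_order_pattern iidX (n := n)
    (F := fun x => (num_retained p x n)%:R)) // => x y xy.
  by congr _%:R; apply: num_retained_ext; exact: order_patternP.
have EA n : E_avg_rank p X n = (a n)%:E.
  rewrite /E_avg_rank (expectation_order_pattern iidX (n := n)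
    (F := fun x => avg_rank p x n)) // => [x|x y xy]; first exact: divr_ge0.
  by apply: avg_rank_ext; exact: order_patternP.
have cE : c_const p X = c%:E.
  apply/cvg_lim => //; apply: cvg_trans (cvg_fin _ _ hc).
  apply: near_eq_cvg; exists 1%N => // n /= n0.
  by rewrite EL inver powR_eq0 pnatr_eq0 eqn0Ngt n0.
split=> [|/b_half ->|/b_gt ->].
- apply: cvg_trans (cvg_fin _ _ hb); apply: near_eq_cvg; exists 2%N => // n /= n1.
  by rewrite EA a_normE.
- by rewrite cE inver pnatr_eq0.
- by rewrite cE.
Qed.
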